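(* Let $\alpha>0$, $\vec\beta=(\beta_1,\beta_2)$, $\kappa$, $\phi$, $u$ be smooth in $\overline\Omega$, where $u$ solves $-\nabla\cdot(\alpha\nabla u)+\vec\beta\cdot\nabla u+\kappa u=\phi$ in $\Omega$, $u=g$ on $\partial\Omega$, and let $\partial\Omega$ be a smooth boundary curve parametrized by $(x,y)=(p(t),q(t))$. Let $(x_i,y_j)$ be an irregular stencil center point of the grid of mesh size $h$, let $(x_i^o,y_j^o)\in\partial\Omega$ be its orthogonal projection onto $\partial\Omega$, and suppose $(x_i^o,y_j^o)=(p(t_k^o),q(t_k^o))$ with $$|q'(t_k^o)/p'(t_k^o)|\ge 1,\qquad q'(t_k^o)\neq\pm p'(t_k^o),\qquad q'(t_k^o)\neq\pm\sqrt3\,p'(t_k^o).$$ Let $S$, $w,v,\mu_r,\tau_\ell$, the $6\times4$ matrices $A_{r,\ell}$ and the constants $\xi_k,\eta_k,\omega_k$ be as defined in the context. Let real numbers $c_{r,\ell,\sigma}$ ($(r,\ell)\in S$, $\sigma=0,1,2,3$) be any solution of $$\sum_{(r,\ell)\in S}A_{r,\ell}\begin{bmatrix}c_{r,\ell,0}\\c_{r,\ell,1}\\c_{r,\ell,2}\\c_{r,\ell,3}\end{bmatrix}=0,\qquad c_{0,0,0}\neq0,\qquad \sum_{(r,\ell)\in S}c_{r,\ell,0}=1,$$ put $C_{r,\ell}=\sum_{\sigma=0}^3c_{r,\ell,\sigma}h^\sigma$, and define \begin{align*} F_{i,j}=\sum_{(r,\ell)\in S}\Big\{&c_{r,\ell,0}\,g+\big[c_{r,\ell,0}\,g^{(1)}\omega_6\tau_\ell+c_{r,\ell,1}\,g\big]h\\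 &+\big[c_{r,\ell,0}\big((\eta_1f+g\omega_1+g^{(1)}\omega_7+g^{(2)}\omega_{12})\tau_\ell^2+\mu_r^2(\eta_3f+g\omega_3+g^{(1)}\omega_9+g^{(2)}\omega_{14})\big)+c_{r,\ell,1}g^{(1)}\omega_6\tau_\ell+c_{r,\ell,2}\,g\big]h^2\\ &+\big[c_{r,\ell,0}\big((\eta_2f+\eta_6f^{(0,1)}+\eta_8f^{(1,0)}+g\omega_2+g^{(1)}\omega_8+g^{(2)}\omega_{13}+g^{(3)}\omega_{17})\tau_\ell^3\\ &\quad+\mu_r^2(\eta_4f+\eta_7f^{(0,1)}+\eta_9f^{(1,0)}+g\omega_4+g^{(1)}\omega_{10}+g^{(2)}\omega_{15}+g^{(3)}\omega_{18})\tau_\ell\\ &\quad+\mu_r^3(\eta_5f+\omega_5g+\omega_{11}g^{(1)}+\omega_{16}g^{(2)}+f^{(1,0)}/6)\big)\\ &\quad+c_{r,\ell,1}(\eta_1f+g\omega_1+g^{(1)}\omega_7+g^{(2)}\omega_{12})\tau_\ell^2+c_{r,\ell,2}g^{(1)}\omega_6\tau_\ell\\ &\quad+c_{r,\ell,1}(\eta_3f+g\omega_3+g^{(1)}\omega_9+g^{(2)}\omega_{14})\mu_r^2+c_{r,\ell,3}\,g\big]h^3\Big\}. \end{align*} Then the compact finite difference scheme $$\mathcal L_h(u_h)_{i,j}:=\sum_{(r,\ell)\in S}C_{r,\ell}\,(u_h)_{i+r,j+\ell}=F_{i,j}$$ achieves fourth-order consistency for the Dirichlet boundary condition $u=g$ at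 the point $(x_i^o,y_j^o)\in\partial\Omega$; that is, $F_{i,j}|_{h=0}=g$ and the exact solution satisfies $$\sum_{(r,\ell)\in S}C_{r,\ell}\,u(x_{i+r},y_{j+\ell})-F_{i,j}=\mathcal O(h^4).$$
   Context: **Setting.** $\Omega\subset\mathbb R^2$ is a domain with smooth boundary curve $\partial\Omega$, with $(0,0)\in\Omega$. Standing regularity: partial derivatives of $u$ up to order 4 and of $\alpha,\vec\beta,\kappa,\phi$ up to order 2 are uniformly continuous on $\overline\Omega$; derivatives of $g$ and of the parametrization $(p(t),q(t))$ of $\partial\Omega$ up to order 3 are uniformly continuous. The boundary condition reads $u(p(t),q(t))=g(t)$. At the parameter considered, $[p'(t_k^o)]^2+[q'(t_k^o)]^2\ne0$. The condition $|q'/p'|\ge1$ means $|q'|\ge|p'|$ (so $p'=0$ is allowed). **Reduced equation.** With $$a=\frac{\alpha_x-\beta_1}{\alpha},\quad b=\frac{\alpha_y-\beta_2}{\alpha},\quad d=-\frac{\kappa}{\alpha},\quad f=-\frac{\phi}{\alpha},$$ the equation becomes $\Delta u+au_x+bu_y+du=f$. **Grid.** $(x_i,y_j)=(ih,jh)$, $i,j\in\mathbb Z$, $h=1/N$, $N\in\mathbb N$, restricted to $\overline\Omega$. A grid point $(x_i,y_j)\in\overline\Omega$ is a regular stencil center if all nine points $(x_{i+\mu},y_{j+\nu})$, $-1\le\mu,\nu\le1$, lie in $\overline\Omega$; otherwise it is an irregular stencil center. $(u_h)_{i,j}$ denotes the value at $(x_i,y_j)$ of the numerical solution. Define $$S=\{(r,\ell):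 (x_i+rh,\,y_j+\ell h)\in\overline\Omega,\ r,\ell\in\{-1,0,1\}\},$$ $$w=(x_i-x_i^o)/h,\quad v=(y_j-y_j^o)/h,\quad \mu_r=r+w,\quad \tau_\ell=\ell+v .$$ **Evaluation convention.** $a,b,d,f$ and $a^{(m,n)}=\partial_x^m\partial_y^na$ (likewise $b^{(m,n)},d^{(m,n)},f^{(m,n)}$) are evaluated at $(x_i^o,y_j^o)$. $g$ and $p^{(m)},q^{(m)},g^{(m)}$ (the $m$-th derivatives in $t$) are evaluated at $t=t_k^o$. In the formulas below write $p_m=p^{(m)}$, $q_m=q^{(m)}$ for $m=1,2,3$; powers such as $p_1^3$ are ordinary powers. **Meaning of $\mathcal O(h^4)$.** As $h\to0$, with the coefficients $c_{r,\ell,\sigma}$ bounded independently of $h$. **Constants.** Put $D_2=p_1^2-q_1^2$, $D_3=3p_1^2-q_1^2$, $D_4=3p_1^4-4p_1^2q_1^2+q_1^4$. $s_1=-p_1/q_1$, $s_2=\{bp_1^3-ap_1^2q_1-p_1q_2+p_2q_1\}/(q_1D_2)$, $s_3=2q_1p_1/D_2$, $s_4=\{b^{(1,0)}p_1^6-q_1(3b^2+a^{(1,0)}-3b^{(0,1)}-2d)p_1^5+([4ab-3a^{(0,1)}-b^{(1,0)}]q_1^2-aq_2)p_1^4+([a^{(1,0)}-a^2-3b^{(0,1)}-2d]q_1^3+(ap_2+6bq_2)q_1-q_3)p_1^3+(3a^{(0,1)}q_1^4-(3aq_2+6bp_2)q_1^2+p_3q_1+3p_2q_2)p_1^2+3(ap_2q_1^2-p_2^2+q_1q_3/3-q_2^2)q_1p_1+3p_2q_2q_1^2-p_3q_1^3\}/(q_1^2D_4)$,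 $s_5=\{3ap_1^2q_1^3-ap_1^4q_1-bp_1^5-5bp_1^3q_1^2+3p_1^3q_2-3p_1^2p_2q_1+3p_1q_1^2q_2-3p_2q_1^3\}/(q_1D_4)$, $s_6=-p_1(p_1^2-3q_1^2)/(q_1D_3)$. $z_1=-1/q_1$, $z_2=dp_1^2/D_2$, $z_3=-p_1^2/D_2$, $z_4=(bp_1^2-q_2)/(q_1D_2)$, $z_5=1/D_2$, $z_6=p_1\{d^{(1,0)}p_1^4-3q_1(bd-d^{(0,1)})p_1^3+q_1^2(ad-d^{(1,0)})p_1^2+(3dq_1q_2-3d^{(0,1)}q_1^3)p_1-3dp_2q_1^2\}/(q_1D_4)$, $z_7=-p_1\{ap_1^2q_1-3bp_1^3+3p_1q_2-3p_2q_1\}/D_4$, $z_8=-3p_1^2/D_3$, $z_9=\{b^{(1,0)}p_1^5-3q_1(b^2-b^{(0,1)}-d)p_1^4+([ab-b^{(1,0)}]q_1^2-aq_2)p_1^3+(6bq_1q_2-3(d+b^{(0,1)})q_1^3-q_3)p_1^2-3p_2(bq_1^2-q_2)p_1+q_3q_1^2-3q_1q_2^2\}/(q_1^2D_4)$, $z_{10}=-p_1^3/(q_1D_3)$, $z_{11}=\{ap_1^3-3bp_1^2q_1-3p_1p_2+3q_1q_2\}/(q_1D_4)$, $z_{12}=1/(q_1D_3)$. $\xi_1=s_1$, $\xi_2=s_2/2$, $\xi_3=s_4/6$, $\xi_4=-(bs_1+a+s_2)/2$, $\xi_5=-[(d+b^{(0,1)})s_1+s_2b+s_4+a^{(0,1)}]/2$,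 $\xi_6=(a^2+(bs_1+s_2)a-s_1b^{(1,0)}-a^{(1,0)}-d)/6$, $\xi_7=s_3/2$, $\xi_8=s_5/6$, $\xi_9=-s_3/2$, $\xi_{10}=-(s_3b+a+s_5)/2$, $\xi_{11}=(s_3a-b)/6$, $\xi_{12}=s_6/6$, $\xi_{13}=-s_6/2$. $\eta_1=-z_3/2$, $\eta_2=-z_7/6$, $\eta_3=(z_3+1)/2$, $\eta_4=(z_3b+z_7)/2$, $\eta_5=-(z_3+1)a/6$, $\eta_6=-z_8/6$, $\eta_7=(z_8+1)/2$, $\eta_8=-z_{10}/6$, $\eta_9=z_{10}/2$. $\omega_1=-z_2/2$, $\omega_2=-z_6/6$, $\omega_3=(z_2-d)/2$, $\omega_4=(z_2b-d^{(0,1)}+z_6)/2$, $\omega_5=[a(d-z_2)-d^{(1,0)}]/6$, $\omega_6=-z_1$, $\omega_7=-z_4/2$, $\omega_8=-z_9/6$, $\omega_9=(bz_1+z_4)/2$, $\omega_{10}=[z_1(b^{(0,1)}+d)+z_4b+z_9]/2$, $\omega_{11}=[b^{(1,0)}z_1-a(bz_1+z_4)]/6$, $\omega_{12}=-z_5/2$, $\omega_{13}=-z_{11}/6$, $\omega_{14}=z_5/2$, $\omega_{15}=(z_5b+z_{11})/2$, $\omega_{16}=-z_5a/6$, $\omega_{17}=-z_{12}/6$, $\omega_{18}=z_{12}/2$. **Matrix.** $$A_{r,\ell}=\begin{bmatrix} \tau_\ell\xi_1+\mu_r&0&0&0\\ \mu_r^2\xi_9+\tau_\ell^2\xi_7+\mu_r\tau_\ell&0&0&0\\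 \mu_r^2\tau_\ell\xi_{13}+\tau_\ell^3\xi_{12}-\mu_r^3/6+\mu_r\tau_\ell^2/2&0&0&0\\ \mu_r^2\xi_4+\tau_\ell^2\xi_2&\tau_\ell\xi_1+\mu_r&0&0\\ \mu_r^3\xi_{11}+\mu_r^2\tau_\ell\xi_{10}+\tau_\ell^3\xi_8&\mu_r^2\xi_9+\tau_\ell^2\xi_7+\mu_r\tau_\ell&0&0\\ \mu_r^3\xi_6+\mu_r^2\tau_\ell\xi_5+\tau_\ell^3\xi_3&\mu_r^2\xi_4+\tau_\ell^2\xi_2&\tau_\ell\xi_1+\mu_r&0 \end{bmatrix}.$$ *)

(* Defs.v *)
From Stdlib Require Export Reals ZArith.
From Stdlib Require Import ClassicalEpsilon.
From Coquelicot Require Export Coquelicot.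
Open Scope R_scope.

(** * Sets and domains *)

Definition interior {X : UniformSpace} (D : X -> Prop) : X -> Prop :=
  fun z => locally z D.

Definition closure {X : UniformSpace} (D : X -> Prop) : X -> Prop :=
  fun z => forall eps : posreal, exists z', D z' /\ ball z eps z'.

Definition frontier {X : UniformSpace} (D : X -> Prop) : X -> Prop :=
  fun z => closure D z /\ closure (fun z' => ~ D z') z.

Definition connected {X : UniformSpace} (D : X -> Prop) : Prop :=
  forall A B : X -> Prop, open A -> open B ->
    (forall z, D z -> A z \/ B z) ->
    (exists z, D z /\ A z) -> (exists z, D z /\ B z) ->
    exists z, D z /\ A z /\ B z.

(** Locally, in a rotated orthonormal frame centered at any boundary point,
    the domain is the strict epigraph of a function of class [C^3]. *)
Definition smooth_boundary (Om : R * R -> Prop) : Prop :=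
  forall z0, frontier Om z0 ->
    exists (e1 e2 r : R) (psi : R -> R),
      e1 ^ 2 + e2 ^ 2 = 1 /\ 0 < r /\ psi 0 = 0 /\
      (forall (n : nat) (s : R), (n <= 3)%nat -> Rabs s < r ->
         ex_derive_n psi n s /\ continuous (Derive_n psi n) s) /\
      (forall s y : R, Rabs s < r -> Rabs y < r ->
         (Om (fst z0 + s * e1 - y * e2, snd z0 + s * e2 + y * e1)
          <-> psi s < y)).

(** A nondegenerate interval of any kind. *)
Definition nontrivial_interval (T : R -> Prop) : Prop :=
  is_connected T /\ exists s t, s < t /\ T s /\ T t.

Definition parametrizes_boundary
    (Om : R * R -> Prop) (T : R -> Prop) (p q : R -> R) : Prop :=
  (forall t, T t -> frontier Om (p t, q t)) /\
  (forall z, frontier Om z -> exists t, T t /\ z = (p t, q t)).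

(** A nearest boundary point. *)
Definition is_projection (Om : R * R -> Prop) (z z0 : R * R) : Prop :=
  frontier Om z0 /\
  forall z1, frontier Om z1 ->
    dist_euc (fst z) (snd z) (fst z0) (snd z0)
    <= dist_euc (fst z) (snd z) (fst z1) (snd z1).

(** * Derivatives and regularity up to the boundary *)

Definition dx (F : R * R -> R) : R * R -> R :=
  fun z => Derive (fun s => F (s, snd z)) (fst z).

Definition dy (F : R * R -> R) : R * R -> R :=
  fun z => Derive (fun s => F (fst z, s)) (snd z).

Definition pder (m n : nat) (F : R * R -> R) : R * R -> R :=
  Nat.iter m dx (Nat.iter n dy F).

Definition ucont_on {X : UniformSpace} (D : X -> Prop) (F : X -> R) : Prop :=
  forall eps : posreal, exists delta : posreal,
    forall z z', D z -> D z' -> ball z delta z' -> ball (F z) eps (F z').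

Fixpoint Ck_open (k : nat) (D : R * R -> Prop) (F : R * R -> R) : Prop :=
  ucont_on D F /\
  match k with
  | O => True
  | S k' =>
      (forall z, D z -> ex_derive (fun s => F (s, snd z)) (fst z) /\
                        ex_derive (fun s => F (fst z, s)) (snd z)) /\
      Ck_open k' D (dx F) /\ Ck_open k' D (dy F)
  end.

(** The derivatives are classical only inside the open set [D]; being uniformly
    continuous there, they have unique uniformly continuous extensions to
    [closure D], and these are the derivatives on the closure. *)
Definition Ck_closure (k : nat) (D : R * R -> Prop) (F : R * R -> R) : Prop :=
  ucont_on (closure D) F /\ Ck_open k D F.

Definition Ck_interval (k : nat) (T : R -> Prop) (F : R -> R) : Prop :=
  ucont_on T F /\
  forall m : nat, (m <= k)%nat ->
    ucont_on (interior T) (Derive_n F m) /\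
    forall t, interior T t -> ex_derive_n F m t.

(** Value at [z] of the continuous extension of [F] from [D] to [closure D]. *)
Definition trace {X : UniformSpace} (D : X -> Prop) (F : X -> R) (z : X) : R :=
  lim (filtermap F (within D (locally z))).

(** * The equation *)

Definition solves_pde (Om : R * R -> Prop)
    (alpha beta1 beta2 kappa phi u : R * R -> R) : Prop :=
  forall z, Om z ->
    - (dx (fun z' => alpha z' * dx u z') z + dy (fun z' => alpha z' * dy u z') z)
    + (beta1 z * dx u z + beta2 z * dy u z) + kappa z * u z = phi z.

Definition coef_a (alpha beta1 : R * R -> R) : R * R -> R :=
  fun z => (dx alpha z - beta1 z) / alpha z.
Definition coef_b (alpha beta2 : R * R -> R) : R * R -> R :=
  fun z => (dy alpha z - beta2 z) / alpha z.
Definition coef_d (alpha kappa : R * R -> R) : R * R -> R :=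
  fun z => - (kappa z / alpha z).
Definition coef_f (alpha phi : R * R -> R) : R * R -> R :=
  fun z => - (phi z / alpha z).

(** * Data at the boundary point *)

(** [a10] is [a^(1,0)] at the boundary point, and so on; [p1] is [p'] at the
    corresponding parameter, and so on; [g0] is the value of [g]. *)
Class bdata := mk_bdata {
  a00 : R; a10 : R; a01 : R;
  b00 : R; b10 : R; b01 : R;
  d00 : R; d10 : R; d01 : R;
  f00 : R; f10 : R; f01 : R;
  p1 : R; p2 : R; p3 : R;
  q1 : R; q2 : R; q3 : R;
  g0 : R; g1 : R; g2 : R; g3 : R }.

(** The parameter [t] may be an endpoint of [T], where the derivatives of
    [p, q, g] are the limits of those in the interior of [T]. *)
Definition boundary_data (Om : R * R -> Prop) (T : R -> Prop)
    (alpha beta1 beta2 kappa phi : R * R -> R) (p q g : R -> R) (t : R)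
    : bdata :=
  let co (F : R * R -> R) (m n : nat) := trace Om (pder m n F) (p t, q t) in
  let cu (F : R -> R) (m : nat) := trace (interior T) (Derive_n F m) t in
  let a := coef_a alpha beta1 in
  let b := coef_b alpha beta2 in
  let d := coef_d alpha kappa in
  let f := coef_f alpha phi in
  {| a00 := co a 0%nat 0%nat; a10 := co a 1%nat 0%nat; a01 := co a 0%nat 1%nat;
     b00 := co b 0%nat 0%nat; b10 := co b 1%nat 0%nat; b01 := co b 0%nat 1%nat;
     d00 := co d 0%nat 0%nat; d10 := co d 1%nat 0%nat; d01 := co d 0%nat 1%nat;
     f00 := co f 0%nat 0%nat; f10 := co f 1%nat 0%nat; f01 := co f 0%nat 1%nat;
     p1 := cu p 1%nat; p2 := cu p 2%nat; p3 := cu p 3%nat;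
     q1 := cu q 1%nat; q2 := cu q 2%nat; q3 := cu q 3%nat;
     g0 := g t; g1 := cu g 1%nat; g2 := cu g 2%nat; g3 := cu g 3%nat |}.

(** * Constants of the scheme *)

Definition D2 {B : bdata} : R := p1^2 - q1^2.
Definition D3 {B : bdata} : R := 3 * p1^2 - q1^2.
Definition D4 {B : bdata} : R := 3 * p1^4 - 4 * p1^2 * q1^2 + q1^4.

Definition s1 {B : bdata} : R := - p1 / q1.
Definition s2 {B : bdata} : R :=
  (b00 * p1^3 - a00 * p1^2 * q1 - p1 * q2 + p2 * q1) / (q1 * D2).
Definition s3 {B : bdata} : R := 2 * q1 * p1 / D2.
Definition s4 {B : bdata} : R :=
  ( b10 * p1^6
    - q1 * (3 * b00^2 + a10 - 3 * b01 - 2 * d00) * p1^5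
    + ((4 * a00 * b00 - 3 * a01 - b10) * q1^2 - a00 * q2) * p1^4
    + ((a10 - a00^2 - 3 * b01 - 2 * d00) * q1^3
       + (a00 * p2 + 6 * b00 * q2) * q1 - q3) * p1^3
    + (3 * a01 * q1^4 - (3 * a00 * q2 + 6 * b00 * p2) * q1^2
       + p3 * q1 + 3 * p2 * q2) * p1^2
    + 3 * (a00 * p2 * q1^2 - p2^2 + q1 * q3 / 3 - q2^2) * q1 * p1
    + 3 * p2 * q2 * q1^2 - p3 * q1^3 ) / (q1^2 * D4).
Definition s5 {B : bdata} : R :=
  ( 3 * a00 * p1^2 * q1^3 - a00 * p1^4 * q1 - b00 * p1^5
    - 5 * b00 * p1^3 * q1^2 + 3 * p1^3 * q2 - 3 * p1^2 * p2 * q1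
    + 3 * p1 * q1^2 * q2 - 3 * p2 * q1^3 ) / (q1 * D4).
Definition s6 {B : bdata} : R := - p1 * (p1^2 - 3 * q1^2) / (q1 * D3).

Definition z1 {B : bdata} : R := - 1 / q1.
Definition z2 {B : bdata} : R := d00 * p1^2 / D2.
Definition z3 {B : bdata} : R := - p1^2 / D2.
Definition z4 {B : bdata} : R := (b00 * p1^2 - q2) / (q1 * D2).
Definition z5 {B : bdata} : R := 1 / D2.
Definition z6 {B : bdata} : R :=
  p1 * ( d10 * p1^4 - 3 * q1 * (b00 * d00 - d01) * p1^3
         + q1^2 * (a00 * d00 - d10) * p1^2
         + (3 * d00 * q1 * q2 - 3 * d01 * q1^3) * p1
         - 3 * d00 * p2 * q1^2 ) / (q1 * D4).
Definition z7 {B : bdata} : R :=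
  - p1 * (a00 * p1^2 * q1 - 3 * b00 * p1^3 + 3 * p1 * q2 - 3 * p2 * q1) / D4.
Definition z8 {B : bdata} : R := - 3 * p1^2 / D3.
Definition z9 {B : bdata} : R :=
  ( b10 * p1^5 - 3 * q1 * (b00^2 - b01 - d00) * p1^4
    + ((a00 * b00 - b10) * q1^2 - a00 * q2) * p1^3
    + (6 * b00 * q1 * q2 - 3 * (d00 + b01) * q1^3 - q3) * p1^2
    - 3 * p2 * (b00 * q1^2 - q2) * p1
    + q3 * q1^2 - 3 * q1 * q2^2 ) / (q1^2 * D4).
Definition z10 {B : bdata} : R := - p1^3 / (q1 * D3).
Definition z11 {B : bdata} : R :=
  (a00 * p1^3 - 3 * b00 * p1^2 * q1 - 3 * p1 * p2 + 3 * q1 * q2) / (q1 * D4).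
Definition z12 {B : bdata} : R := 1 / (q1 * D3).

Definition xi1 {B : bdata} : R := s1.
Definition xi2 {B : bdata} : R := s2 / 2.
Definition xi3 {B : bdata} : R := s4 / 6.
Definition xi4 {B : bdata} : R := - (b00 * s1 + a00 + s2) / 2.
Definition xi5 {B : bdata} : R := - ((d00 + b01) * s1 + s2 * b00 + s4 + a01) / 2.
Definition xi6 {B : bdata} : R :=
  (a00^2 + (b00 * s1 + s2) * a00 - s1 * b10 - a10 - d00) / 6.
Definition xi7 {B : bdata} : R := s3 / 2.
Definition xi8 {B : bdata} : R := s5 / 6.
Definition xi9 {B : bdata} : R := - s3 / 2.
Definition xi10 {B : bdata} : R := - (s3 * b00 + a00 + s5) / 2.
Definition xi11 {B : bdata} : R := (s3 * a00 - b00) / 6.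
Definition xi12 {B : bdata} : R := s6 / 6.
Definition xi13 {B : bdata} : R := - s6 / 2.

Definition eta1 {B : bdata} : R := - z3 / 2.
Definition eta2 {B : bdata} : R := - z7 / 6.
Definition eta3 {B : bdata} : R := (z3 + 1) / 2.
Definition eta4 {B : bdata} : R := (z3 * b00 + z7) / 2.
Definition eta5 {B : bdata} : R := - (z3 + 1) * a00 / 6.
Definition eta6 {B : bdata} : R := - z8 / 6.
Definition eta7 {B : bdata} : R := (z8 + 1) / 2.
Definition eta8 {B : bdata} : R := - z10 / 6.
Definition eta9 {B : bdata} : R := z10 / 2.

Definition om1 {B : bdata} : R := - z2 / 2.
Definition om2 {B : bdata} : R := - z6 / 6.
Definition om3 {B : bdata} : R := (z2 - d00) / 2.
Definition om4 {B : bdata} : R := (z2 * b00 - d01 + z6) / 2.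
Definition om5 {B : bdata} : R := (a00 * (d00 - z2) - d10) / 6.
Definition om6 {B : bdata} : R := - z1.
Definition om7 {B : bdata} : R := - z4 / 2.
Definition om8 {B : bdata} : R := - z9 / 6.
Definition om9 {B : bdata} : R := (b00 * z1 + z4) / 2.
Definition om10 {B : bdata} : R := (z1 * (b01 + d00) + z4 * b00 + z9) / 2.
Definition om11 {B : bdata} : R := (b10 * z1 - a00 * (b00 * z1 + z4)) / 6.
Definition om12 {B : bdata} : R := - z5 / 2.
Definition om13 {B : bdata} : R := - z11 / 6.
Definition om14 {B : bdata} : R := z5 / 2.
Definition om15 {B : bdata} : R := (z5 * b00 + z11) / 2.
Definition om16 {B : bdata} : R := - z5 * a00 / 6.
Definition om17 {B : bdata} : R := - z12 / 6.
Definition om18 {B : bdata} : R := z12 / 2.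

(** * The scheme *)

Definition stencil_matrix {B : bdata} (mu tau : R) : @matrix R 6 4 :=
  let m11 := tau * xi1 + mu in
  let m21 := mu^2 * xi9 + tau^2 * xi7 + mu * tau in
  let m31 := mu^2 * tau * xi13 + tau^3 * xi12 - mu^3 / 6 + mu * tau^2 / 2 in
  let m41 := mu^2 * xi4 + tau^2 * xi2 in
  let m51 := mu^3 * xi11 + mu^2 * tau * xi10 + tau^3 * xi8 in
  let m61 := mu^3 * xi6 + mu^2 * tau * xi5 + tau^3 * xi3 in
  [[ m11, 0,   0,   0 ],
   [ m21, 0,   0,   0 ],
   [ m31, 0,   0,   0 ],
   [ m41, m11, 0,   0 ],
   [ m51, m21, 0,   0 ],
   [ m61, m41, m11, 0 ]].

Definition grid_point (h : R) (i j : Z) : R * R := (IZR i * h, IZR j * h).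

(** The set [S] attached to the center [(i, j)]. *)
Definition in_stencil (Om : R * R -> Prop) (h : R) (i j r l : Z) : Prop :=
  (-1 <= r <= 1)%Z /\ (-1 <= l <= 1)%Z /\
  closure Om (grid_point h (i + r) (j + l)).

Definition irregular_center (Om : R * R -> Prop) (h : R) (i j : Z) : Prop :=
  closure Om (grid_point h i j) /\
  ~ (forall m n : Z, (-1 <= m <= 1)%Z -> (-1 <= n <= 1)%Z ->
       closure Om (grid_point h (i + m) (j + n))).

(** Sum of [F r l] over the pairs [(r, l)] of [{-1, 0, 1}^2] satisfying [S]. *)
Definition sum_stencil {G : AbelianMonoid}
    (S : Z -> Z -> Prop) (F : Z -> Z -> G) : G :=
  sum_n (fun m => sum_n (fun n =>
    let r := (Z.of_nat m - 1)%Z in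
    let l := (Z.of_nat n - 1)%Z in
    if excluded_middle_informative (S r l) then F r l else zero) 2) 2.

(** [c r l sigma] stands for [c_{r,l,sigma}]. *)
Definition coef_vector (c : Z -> Z -> nat -> R) (r l : Z) : @matrix R 4 1 :=
  mk_matrix 4 1 (fun sigma _ => c r l sigma).

Definition solves_system {B : bdata} (S : Z -> Z -> Prop) (w v : R)
    (c : Z -> Z -> nat -> R) : Prop :=
  sum_stencil S (fun r l =>
    Mmult (stencil_matrix (IZR r + w) (IZR l + v)) (coef_vector c r l)) = Mzero /\
  c 0%Z 0%Z 0%nat <> 0 /\
  sum_stencil S (fun r l => c r l 0%nat) = 1.

Definition scheme_coef (h : R) (c : Z -> Z -> nat -> R) (r l : Z) : R :=
  sum_n (fun sigma => c r l sigma * h ^ sigma) 3.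

(** The operator [L_h] applied at [(i, j)] to a grid function [U]. *)
Definition scheme_op (S : Z -> Z -> Prop) (h : R) (c : Z -> Z -> nat -> R)
    (U : Z -> Z -> R) (i j : Z) : R :=
  sum_stencil S (fun r l => scheme_coef h c r l * U (i + r)%Z (j + l)%Z).

(** [F_{i,j}] as a polynomial in its explicit argument [h], the offsets
    [w, v] and the coefficients [c] being held fixed. *)
Definition scheme_rhs {B : bdata} (S : Z -> Z -> Prop) (w v : R)
    (c : Z -> Z -> nat -> R) (h : R) : R :=
  sum_stencil S (fun r l =>
    let mu := IZR r + w in
    let tau := IZR l + v in
    let c0 := c r l 0%nat in
    let c1 := c r l 1%nat in
    let c2 := c r l 2%nat in
    let c3 := c r l 3%nat in
    c0 * g0
    + (c0 * g1 * om6 * tau + c1 * g0) * h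
    + ( c0 * ( (eta1 * f00 + g0 * om1 + g1 * om7 + g2 * om12) * tau^2
               + mu^2 * (eta3 * f00 + g0 * om3 + g1 * om9 + g2 * om14) )
        + c1 * g1 * om6 * tau + c2 * g0 ) * h^2
    + ( c0 * ( (eta2 * f00 + eta6 * f01 + eta8 * f10
                + g0 * om2 + g1 * om8 + g2 * om13 + g3 * om17) * tau^3
               + mu^2 * (eta4 * f00 + eta7 * f01 + eta9 * f10
                + g0 * om4 + g1 * om10 + g2 * om15 + g3 * om18) * tau
               + mu^3 * (eta5 * f00 + om5 * g0 + om11 * g1 + om16 * g2
                + f10 / 6) )
        + c1 * (eta1 * f00 + g0 * om1 + g1 * om7 + g2 * om12) * tau^2
        + c2 * g1 * om6 * tau
        + c1 * (eta3 * f00 + g0 * om3 + g1 * om9 + g2 * om14) * mu^2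
        + c3 * g0 ) * h^3).

(* Main.v *)
Require Import Defs.
From Stdlib Require Import Lra Lia Classical ClassicalEpsilon.
Open Scope R_scope.

(** The scheme is built so that, at an irregular center, the Taylor expansion of
    the solution about the projected boundary point reproduces the right-hand
    side up to fourth order.

    At a boundary point the solution has nine derivatives of order one to three.
    The equation, its two first derivatives, and the boundary condition
    differentiated one, two and three times along the curve are six linear
    relations between them. Under the conditions imposed on [p1] and [q1] the
    pivots [q1], [D2] and [D4 = D2 * D3] do not vanish, so all derivatives are
    combinations of [u_x], [u_xy], [u_xyy] and the data
    ([derivatives_from_boundary_system]). Multiply the coefficient polynomial of
    a stencil point by the Taylor polynomial of the solution there and truncate
    the product after [h ^ 3]. The data part is the right-hand side, and the
    coefficients of [u_x], [u_xy], [u_xyy] are the rows of the linear system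
    ([truncated_product]), which sum to zero over the stencil. What is left is
    the Taylor remainder and the terms of the product beyond [h ^ 3], both
    [O(h^4)] because the center lies within [2 h] of the boundary point
    ([projection_close]).

    The analytic difficulty is that all regularity is inside the domain: the
    derivatives of [u] have limits at the boundary, but [u] need not be
    differentiable there. Hence Taylor's theorem is first proved for two points
    of the domain joined by two segments inside it ([taylor_two_segments]). A
    domain that is locally the epigraph of a function with bounded slope has
    such segments, of length comparable to the distance of the points
    ([boundary_quasiconvex]). Both points may then move to the boundary, the
    derivatives becoming their limits ([taylor_boundary]). To first order, this
    expansion gives a chain rule for the limits along the boundary curve
    ([trace_chain_rule]), which is what differentiating the boundary condition
    requires. The relations coming from the equation are limits of relations
    that hold inside ([reduced_equation_trace]). Compactness of the part of the
    boundary in a square makes all constants uniform ([uniform_taylor]). *)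

(** * Limits and traces *)

(** Derivatives come out of the composition rules in a form that only agrees
    with the wanted one after computation: this leaves the two to be compared. *)
Ltac is_derive_by P :=
  match type of P with is_derive _ _ ?l =>
    match goal with |- is_derive _ _ ?m => replace m with l; [exact P|] end end.

(** Equalities stated at a carrier of the algebraic hierarchy are restated in [R],
    where they are polynomial identities. *)
Ltac real_ring := match goal with |- ?a = ?b => change (@eq R a b) end; ring.

Lemma lim_plus {T : Type} (F : (T -> Prop) -> Prop) {FF : Filter F} (f g : T -> R) (a b : R) :
  filterlim f F (locally a) -> filterlim g F (locally b) ->
  filterlim (fun x => f x + g x) F (locally (a + b)).
Proof.
  intros Hf Hg. apply (filterlim_comp_2 f g Rplus Hf Hg).
  exact (filterlim_plus (V := R_NormedModule) a b).
Qed.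

Lemma lim_mult {T : Type} (F : (T -> Prop) -> Prop) {FF : Filter F} (f g : T -> R) (a b : R) :
  filterlim f F (locally a) -> filterlim g F (locally b) ->
  filterlim (fun x => f x * g x) F (locally (a * b)).
Proof.
  intros Hf Hg. apply (filterlim_comp_2 f g Rmult Hf Hg).
  exact (filterlim_mult (K := R_AbsRing) a b).
Qed.

Lemma lim_opp {T : Type} (F : (T -> Prop) -> Prop) (f : T -> R) (a : R) :
  filterlim f F (locally a) -> filterlim (fun x => - f x) F (locally (- a)).
Proof.
  intros Hf. apply (filterlim_comp _ _ _ f Ropp _ _ _ Hf).
  exact (filterlim_opp (V := R_NormedModule) a).
Qed.

Lemma lim_inv {T : Type} (F : (T -> Prop) -> Prop) (f : T -> R) (a : R) :
  a <> 0 -> filterlim f F (locally a) -> filterlim (fun x => / f x) F (locally (/ a)).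
Proof.
  intros Ha Hf. apply (filterlim_comp _ _ _ f Rinv _ _ _ Hf).
  apply (filterlim_Rbar_inv (Finite a)). intro E; apply Ha; congruence.
Qed.

Lemma lim_abs {T : Type} (F : (T -> Prop) -> Prop) (f : T -> R) (a : R) :
  filterlim f F (locally a) -> filterlim (fun x => Rabs (f x)) F (locally (Rabs a)).
Proof.
  intros Hf. apply (filterlim_comp _ _ _ f Rabs _ _ _ Hf).
  exact (continuous_Rabs a).
Qed.

Lemma lim_le {T : Type} (F : (T -> Prop) -> Prop) {FF : ProperFilter F} (f : T -> R) (a b : R) :
  filterlim f F (locally a) -> F (fun x => f x <= b) -> a <= b.
Proof.
  intros Hf Hb.
  exact (filterlim_le (F := F) f (fun _ => b) (Finite a) (Finite b) Hb Hf
           (filterlim_const (U := R_UniformSpace) b)).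
Qed.

Lemma lim_unique {T : Type} (F : (T -> Prop) -> Prop) {FF : ProperFilter F} (f : T -> R) (a b : R) :
  filterlim f F (locally a) -> filterlim f F (locally b) -> a = b.
Proof. apply (filterlim_locally_unique (V := R_NormedModule) f). Qed.

Lemma within_closure_proper {X : UniformSpace} (D : X -> Prop) (z : X) :
  closure D z -> ProperFilter (within D (locally z)).
Proof.
  intros Hz. split.
  - intros P [eps HP]. destruct (Hz eps) as [z' [Dz' Bz']]. exists z'; auto.
  - apply within_filter, locally_filter.
Qed.

Lemma subset_closure {X : UniformSpace} (D : X -> Prop) (z : X) : D z -> closure D z.
Proof. intros Dz eps. exists z; split; auto. apply ball_center. Qed.

(** The trace is a limit chosen for an arbitrary filter, so it carries
    information only where an actual limit is known to exist. *)
Lemma trace_eq {X : UniformSpace} (D : X -> Prop) (F : X -> R) (z : X) (l : R) :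
  closure D z -> filterlim F (within D (locally z)) (locally l) -> trace D F z = l.
Proof.
  intros Hz Hl. pose proof (within_closure_proper D z Hz) as PF.
  apply (lim_unique (within D (locally z)) F); auto.
  assert (C : cauchy (T := R_CompleteSpace) (filtermap F (within D (locally z)))).
  { intro eps. exists l. apply Hl. exists eps. auto. }
  intros P [eps HP].
  pose proof (complete_cauchy (T := R_CompleteSpace) (filtermap F (within D (locally z)))
    ltac:(apply filtermap_proper_filter; exact PF) C eps) as H.
  unfold filtermap in *. revert H. apply filter_imp. intros x Hx. apply HP. exact Hx.
Qed.

Definition converges {X : UniformSpace} (D : X -> Prop) (F : X -> R) (z : X) : Prop :=
  filterlim F (within D (locally z)) (locally (trace D F z)).

Lemma converges_to {X : UniformSpace} (D : X -> Prop) (F : X -> R) (z : X) (l : R) :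
  closure D z -> filterlim F (within D (locally z)) (locally l) -> converges D F z.
Proof. intros Hz H. unfold converges. rewrite (trace_eq D F z l); auto. Qed.

(** Cauchy's criterion: points of [D] close to [z] are close to each other. *)
Lemma ucont_converges {X : UniformSpace} (D : X -> Prop) (F : X -> R) (z : X) :
  ucont_on D F -> closure D z -> converges D F z.
Proof.
  intros HF Hz. pose proof (within_closure_proper D z Hz) as PF.
  destruct (proj1 (filterlim_locally_cauchy (U := R_CompleteSpace) (F := within D (locally z)) F)) as [l Hl].
  - intro eps. destruct (HF eps) as [delta Hd].
    exists (fun y => D y /\ ball z (pos_div_2 delta) y). split.
    + exists (pos_div_2 delta). intros y By Dy; auto.
    + intros x y [Dx Bx] [Dy By]. apply Hd; auto.
      replace (pos delta) with (pos_div_2 delta + pos_div_2 delta) by (simpl; lra).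
      apply ball_triangle with z; auto. now apply ball_sym.
  - exact (converges_to D F z l Hz Hl).
Qed.

Lemma trace_on_closure {X : UniformSpace} (D : X -> Prop) (F : X -> R) (z : X) :
  ucont_on (closure D) F -> closure D z -> trace D F z = F z.
Proof.
  intros HF Hz. apply trace_eq; auto.
  intros P [eps HP]. destruct (HF eps) as [delta Hd].
  exists delta. intros y By Dy. apply HP, Hd; auto. now apply subset_closure.
Qed.

Lemma trace_ext {X : UniformSpace} (D : X -> Prop) (F G : X -> R) (z : X) :
  closure D z -> (forall z', D z' -> F z' = G z') -> converges D F z ->
  trace D G z = trace D F z.
Proof.
  intros Hz E HF. apply trace_eq; auto.
  eapply filterlim_ext_loc; [|exact HF]. exists (mkposreal 1 Rlt_0_1). auto.
Qed.

Lemma converges_ext {X : UniformSpace} (D : X -> Prop) (F G : X -> R) (z : X) :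
  closure D z -> (forall z', D z' -> F z' = G z') -> converges D F z -> converges D G z.
Proof.
  intros Hz E HF. unfold converges. rewrite (trace_ext D F G); auto.
  eapply filterlim_ext_loc; [|exact HF]. exists (mkposreal 1 Rlt_0_1). auto.
Qed.

(** The traces at two nearby points of the closure are compared through two
    points of [D], each approximating one of the traces within a third of
    [eps]. *)
Lemma trace_continuous {X : UniformSpace} (D : X -> Prop) (F : X -> R) (z : X) :
  ucont_on D F -> closure D z ->
  filterlim (trace D F) (within (closure D) (locally z)) (locally (trace D F z)).
Proof.
  intros HF Hz P [eps HP].
  set (e3 := mkposreal (eps / 3) (Rdiv_lt_0_compat eps 3 (cond_pos eps) ltac:(lra))).
  destruct (HF e3) as [delta Hd].
  set (d3 := mkposreal (delta / 3) (Rdiv_lt_0_compat delta 3 (cond_pos delta) ltac:(lra))).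
  assert (near : forall y, closure D y ->
    exists y', D y' /\ ball y d3 y' /\ ball (trace D F y) e3 (F y')).
  { intros y Hy. destruct (ucont_converges D F y HF Hy (ball (trace D F y) e3)) as [r Hr].
    { exists e3; auto. }
    destruct (Hy (mkposreal (Rmin r d3) (Rmin_pos _ _ (cond_pos r) (cond_pos d3)))) as [y' [Dy' By']].
    exists y'. repeat split; auto.
    - eapply ball_le; [|exact By']. apply Rmin_r.
    - apply Hr; auto. eapply ball_le; [|exact By']. apply Rmin_l. }
  exists d3. intros y By Cy. apply HP.
  destruct (near z Hz) as [z' [Dz' [Bz' Tz']]]. destruct (near y Cy) as [y' [Dy' [By' Ty']]].
  replace (pos eps) with ((e3 + e3) + e3) by (unfold e3; simpl; lra).
  apply ball_triangle with (F y'); [|now apply ball_sym].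
  apply ball_triangle with (F z'); auto. apply Hd; auto.
  replace (pos delta) with ((d3 + d3) + d3) by (unfold d3; simpl; lra).
  apply ball_triangle with y; auto. apply ball_triangle with z; auto. now apply ball_sym.
Qed.

Ltac lims :=
  match goal with
  | |- filterlim (fun _ => _ + _) _ _ => apply lim_plus; [exact _ | lims | lims]
  | |- filterlim (fun _ => _ * _) _ _ => apply lim_mult; [exact _ | lims | lims]
  | _ => assumption
  end.

(** * Partial derivatives in an open set *)

(** The two partial derivatives are treated at once: [pd true] is convertible to
    [dx] and [pd false] to [dy]. *)
Definition slice (b : bool) (z : R * R) (s : R) : R * R :=
  if b then (s, snd z) else (fst z, s).
Definition coord (b : bool) (z : R * R) : R := if b then fst z else snd z.
Definition pd (b : bool) (F : R * R -> R) (z : R * R) : R :=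
  Derive (fun s => F (slice b z s)) (coord b z).
Definition pdable (b : bool) (F : R * R -> R) (z : R * R) : Prop :=
  ex_derive (fun s => F (slice b z s)) (coord b z).

Lemma slice_coord (b : bool) (z : R * R) : slice b z (coord b z) = z.
Proof. destruct b, z; reflexivity. Qed.

Lemma open_slice (D : R * R -> Prop) (b : bool) (z : R * R) :
  open D -> D z -> locally (coord b z) (fun s => D (slice b z s)).
Proof.
  intros HD Dz. destruct (HD z Dz) as [eps He]. exists eps. intros s Hs. apply He.
  destruct b; split; simpl; auto; apply ball_center.
Qed.

Lemma pd_ext (D : R * R -> Prop) (b : bool) (F G : R * R -> R) (z : R * R) :
  open D -> (forall z', D z' -> F z' = G z') -> D z -> pd b F z = pd b G z.
Proof.
  intros HD E Dz. apply Derive_ext_loc.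
  generalize (open_slice D b z HD Dz). apply filter_imp. intros s Hs. apply E, Hs.
Qed.

Lemma Ck_open_ucont (k : nat) (D : R * R -> Prop) (F : R * R -> R) :
  Ck_open k D F -> ucont_on D F.
Proof. destruct k; intros H; apply H. Qed.

Lemma Ck_open_pdable (k : nat) (D : R * R -> Prop) (F : R * R -> R) (b : bool) (z : R * R) :
  Ck_open (S k) D F -> D z -> pdable b F z.
Proof. intros [_ [H _]] Dz. destruct b; apply H, Dz. Qed.

Lemma Ck_open_pd (k : nat) (D : R * R -> Prop) (F : R * R -> R) (b : bool) :
  Ck_open (S k) D F -> Ck_open k D (pd b F).
Proof. intros [_ [_ [H1 H2]]]. destruct b; assumption. Qed.

Lemma Ck_open_pred (k : nat) (D : R * R -> Prop) (F : R * R -> R) :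
  Ck_open (S k) D F -> Ck_open k D F.
Proof.
  revert F. induction k as [|k IH]; intros F [H0 [H1 [H2 H3]]].
  - split; auto.
  - split; [|split; [|split]]; auto.
Qed.

Lemma Ck_open_le (j k : nat) (D : R * R -> Prop) (F : R * R -> R) :
  (j <= k)%nat -> Ck_open k D F -> Ck_open j D F.
Proof. intros Hjk. induction Hjk; auto. intro H. apply IHHjk, Ck_open_pred, H. Qed.

Lemma ucont_continuous (D : R * R -> Prop) (F : R * R -> R) (z : R * R) :
  open D -> ucont_on D F -> D z -> continuous F z.
Proof.
  intros HD HF Dz P [eps HP]. destruct (HF eps) as [d Hd]. destruct (HD z Dz) as [r Hr].
  exists (mkposreal (Rmin d r) (Rmin_pos _ _ (cond_pos d) (cond_pos r))).
  intros y By. apply HP, Hd; auto.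
  - apply Hr. eapply ball_le; [|exact By]. apply Rmin_r.
  - eapply ball_le; [|exact By]. apply Rmin_l.
Qed.

Lemma mixed_partials (D : R * R -> Prop) (F : R * R -> R) (z : R * R) :
  open D -> Ck_open 2 D F -> D z -> dx (dy F) z = dy (dx F) z.
Proof.
  intros HD HF Dz. destruct z as [x y].
  assert (cont : forall b c, continuity_2d_pt (fun u v => pd b (pd c F) (u, v)) x y).
  { intros b c. apply continuity_2d_pt_filterlim. 
    apply (filterlim_ext (fun z => pd b (pd c F) z)); [intros [u v]; reflexivity|].
    apply (ucont_continuous D); auto. 
    apply (Ck_open_ucont 0). apply Ck_open_pd, Ck_open_pd, HF. }
  apply (Schwarz (fun u v => F (u, v)) x y).
  - apply locally_2d_locally. generalize (HD _ Dz). apply filter_imp. intros [u v] Duv.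
    repeat split.
    + exact (Ck_open_pdable _ _ _ true _ HF Duv).
    + exact (Ck_open_pdable _ _ _ false _ HF Duv).
    + exact (Ck_open_pdable _ _ _ true _ (Ck_open_pd _ _ _ false HF) Duv).
    + exact (Ck_open_pdable _ _ _ false _ (Ck_open_pd _ _ _ true HF) Duv).
  - exact (cont true false).
  - exact (cont false true).
Qed.

(** Continuity of the partial derivatives makes the function differentiable, so
    it can be followed along any line, which the slanted segments below need. *)
Lemma line_derivative (D : R * R -> Prop) (F : R * R -> R) (z : R * R) (X Y : R) :
  open D -> Ck_open 1 D F -> D z ->
  is_derive (fun th => F (fst z + th * X, snd z + th * Y)) 0 (X * dx F z + Y * dy F z).
Proof.
  intros HD HF Dz. destruct z as [x y]; simpl.
  assert (Hd : differentiable_pt_lim (fun u v => F (u, v)) x y (dx F (x, y)) (dy F (x, y))).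
  { apply filterdiff_differentiable_pt_lim.
    apply (is_derive_filterdiff (fun u v => F (u, v)) x y (fun u v => dx F (u, v)) (dy F (x, y))).
    - generalize (HD _ Dz). apply filter_imp. intros [u v] Duv.
      apply Derive_correct. exact (Ck_open_pdable _ _ _ true _ HF Duv).
    - apply Derive_correct. exact (Ck_open_pdable _ _ _ false _ HF Dz).
    - apply (continuous_ext (dx F)); [intros [u v]; reflexivity|].
      apply (ucont_continuous D); auto. apply HF. }
  apply is_derive_Reals.
  replace (X * dx F (x, y) + Y * dy F (x, y)) with (dx F (x, y) * X + dy F (x, y) * Y) by ring.
  apply (derivable_pt_lim_comp_2d (fun u v => F (u, v)) (fun th => x + th * X) (fun th => y + th * Y)).
  - replace (x + 0 * X) with x by ring. replace (y + 0 * Y) with y by ring. exact Hd.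
  - apply is_derive_Reals. auto_derive; auto; ring.
  - apply is_derive_Reals. auto_derive; auto; ring.
Qed.

Lemma pd_plus (b : bool) (F G : R * R -> R) (z : R * R) :
  pdable b F z -> pdable b G z ->
  pdable b (fun z' => F z' + G z') z /\ pd b (fun z' => F z' + G z') z = pd b F z + pd b G z.
Proof.
  intros HF HG. split.
  - apply (ex_derive_plus (V := R_NormedModule) _ _ _ HF HG).
  - apply (Derive_plus _ _ _ HF HG).
Qed.

Lemma pd_opp (b : bool) (F : R * R -> R) (z : R * R) :
  pdable b F z ->
  pdable b (fun z' => - F z') z /\ pd b (fun z' => - F z') z = - pd b F z.
Proof.
  intros HF. split.
  - apply (ex_derive_opp (V := R_NormedModule) _ _ HF).
  - apply Derive_opp.
Qed.

Lemma pd_mult (b : bool) (F G : R * R -> R) (z : R * R) :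
  pdable b F z -> pdable b G z ->
  pdable b (fun z' => F z' * G z') z /\
  pd b (fun z' => F z' * G z') z = pd b F z * G z + F z * pd b G z.
Proof.
  intros HF HG. split.
  - apply (ex_derive_mult _ _ _ HF HG).
  - unfold pd. rewrite (Derive_mult _ _ _ HF HG), slice_coord. reflexivity.
Qed.

Lemma pd_div (b : bool) (F G : R * R -> R) (z : R * R) :
  pdable b F z -> pdable b G z -> G z <> 0 ->
  pdable b (fun z' => F z' / G z') z /\
  pd b (fun z' => F z' / G z') z = (pd b F z * G z - F z * pd b G z) / (G z) ^ 2.
Proof.
  intros HF HG Hz. split.
  - apply (ex_derive_div _ _ _ HF HG). rewrite slice_coord; auto.
  - unfold pd. rewrite (Derive_div _ _ _ HF HG); rewrite ?slice_coord; auto.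
Qed.

(** * Taylor polynomials in two variables *)

(** This is [(X dx + Y dy) ^ j F / j!], the homogeneous part of degree [j] of the
    Taylor expansion. Euler's identity for homogeneous polynomials is built into
    the recursion, and the functional [ev] says where the derivatives are taken:
    at an inner point, or as a limit at a boundary point. *)
Fixpoint hom (ev : (R * R -> R) -> R) (j : nat) (F : R * R -> R) (X Y : R) : R :=
  match j with
  | O => ev F
  | S j' => (X * hom ev j' (dx F) X Y + Y * hom ev j' (dy F) X Y) / INR (S j')
  end.

Definition taylor (ev : (R * R -> R) -> R) (k : nat) (F : R * R -> R) (X Y : R) : R :=
  sum_n (fun j => hom ev j F X Y) k.

Definition at_point (z : R * R) (F : R * R -> R) : R := F z.

Lemma hom_ext (D : R * R -> Prop) (j : nat) (F G : R * R -> R) (z : R * R) (X Y : R) :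
  open D -> (forall z', D z' -> F z' = G z') -> D z ->
  hom (at_point z) j F X Y = hom (at_point z) j G X Y.
Proof.
  intros HD E Dz. revert F G E. induction j as [|j IH]; intros F G E; simpl hom.
  - apply E, Dz.
  - rewrite (IH (dx F) (dx G)), (IH (dy F) (dy G)); auto.
    + intros z' Dz'. exact (pd_ext D false F G z' HD E Dz').
    + intros z' Dz'. exact (pd_ext D true F G z' HD E Dz').
Qed.

Lemma hom_scale (ev : (R * R -> R) -> R) (j : nat) (F : R * R -> R) (h X Y : R) :
  hom ev j F (h * X) (h * Y) = h ^ j * hom ev j F X Y.
Proof.
  revert F. induction j as [|j IH]; intros F; simpl hom.
  - simpl; ring.
  - rewrite !IH. change (h ^ S j) with (h * h ^ j). unfold Rdiv. ring.
Qed.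

Lemma derivative_of_combination (f g : R -> R) (x y X Y n a b : R) :
  is_derive f 0 a -> is_derive g 0 b ->
  is_derive (fun th => ((x + th * X) * f th + (y + th * Y) * g th) / n) 0
    ((X * f 0 + x * a + (Y * g 0 + y * b)) / n).
Proof.
  intros Hf Hg. auto_derive.
  - repeat split; eexists; eassumption.
  - change (fun x => f x) with f. change (fun x => g x) with g.
    rewrite (is_derive_unique _ _ _ Hf), (is_derive_unique _ _ _ Hg).
    unfold Rdiv. ring.
Qed.

(** The gradient of the part of degree [j + 1] of [F] consists of the parts of
    degree [j] of [dx F] and [dy F]. By induction, the derivatives of the two
    factors [hom (dx F)] and [hom (dy F)] contribute [j] times the same value
    once the mixed derivatives are exchanged, and the product rule adds the
    missing one. *)
Lemma hom_line_derivative (D : R * R -> Prop) (j : nat) (F : R * R -> R) (z : R * R)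
    (x y X Y : R) :
  open D -> Ck_open (S j) D F -> D z ->
  is_derive (fun th => hom (at_point z) (S j) F (x + th * X) (y + th * Y)) 0
    (X * hom (at_point z) j (dx F) x y + Y * hom (at_point z) j (dy F) x y).
Proof.
  intros HD HF Dz. revert F HF. induction j as [|j IH]; intros F HF.
  - simpl. auto_derive; auto. field.
  - set (H := hom (at_point z)) in *.
    pose proof (IH (dx F) (Ck_open_pd _ _ _ true HF)) as Dx.
    pose proof (IH (dy F) (Ck_open_pd _ _ _ false HF)) as Dy.
    assert (E : H j (dx (dy F)) x y = H j (dy (dx F)) x y).
    { apply (hom_ext D); auto. intros z' Dz'. apply (mixed_partials D); auto.
      apply (Ck_open_le 2 (S (S j))); auto. lia. }
    assert (n0 : INR (S (S j)) <> 0) by (apply not_0_INR; lia).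
    assert (n1 : INR (S j) <> 0) by (apply not_0_INR; lia).
    change (is_derive (fun th =>
       ((x + th * X) * H (S j) (dx F) (x + th * X) (y + th * Y)
        + (y + th * Y) * H (S j) (dy F) (x + th * X) (y + th * Y)) / INR (S (S j))) 0
       (X * H (S j) (dx F) x y + Y * H (S j) (dy F) x y)).
    assert (V : forall G, H (S j) G (x + 0 * X) (y + 0 * Y)
                          = (x * H j (dx G) x y + y * H j (dy G) x y) / INR (S j)).
    { intro G. replace (x + 0 * X) with x by ring. replace (y + 0 * Y) with y by ring. reflexivity. }
    pose proof (derivative_of_combination _ _ x y X Y (INR (S (S j))) _ _ Dx Dy) as P.
    cbv beta in P. rewrite !V in P.
    is_derive_by P.
    change (H (S j) (dx F) x y) with ((x * H j (dx (dx F)) x y + y * H j (dy (dx F)) x y) / INR (S j)).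
    change (H (S j) (dy F) x y) with ((x * H j (dx (dy F)) x y + y * H j (dy (dy F)) x y) / INR (S j)).
    rewrite E. rewrite (S_INR (S j)) in *. field; auto.
Qed.

Lemma taylor_S (ev : (R * R -> R) -> R) (k : nat) (F : R * R -> R) (X Y : R) :
  taylor ev (S k) F X Y = taylor ev k F X Y + hom ev (S k) F X Y.
Proof. unfold taylor. rewrite sum_Sn. reflexivity. Qed.

Lemma taylor_line_derivative (D : R * R -> Prop) (k : nat) (F : R * R -> R) (z : R * R)
    (x y X Y : R) :
  open D -> Ck_open (S k) D F -> D z ->
  is_derive (fun th => taylor (at_point z) (S k) F (x + th * X) (y + th * Y)) 0
    (X * taylor (at_point z) k (dx F) x y + Y * taylor (at_point z) k (dy F) x y).
Proof.
  intros HD HF Dz. induction k as [|k IH].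
  - apply (is_derive_ext (fun th => F z + hom (at_point z) 1 F (x + th * X) (y + th * Y))).
    { intro t. rewrite taylor_S. unfold taylor. rewrite sum_O. reflexivity. }
    pose proof (hom_line_derivative D 0 F z x y X Y HD HF Dz) as H.
    unfold taylor; rewrite !sum_O.
    apply (is_derive_plus (V := R_NormedModule) (fun _ => F z)) with (1 := is_derive_const (F z) 0) in H.
    rewrite plus_zero_l in H. exact H.
  - apply (is_derive_ext (fun th => taylor (at_point z) (S k) F (x + th * X) (y + th * Y)
             + hom (at_point z) (S (S k)) F (x + th * X) (y + th * Y))).
    { intro t. rewrite (taylor_S _ (S k)). reflexivity. }
    rewrite !taylor_S.
    pose proof (hom_line_derivative D (S k) F z x y X Y HD HF Dz) as H.
    pose proof (IH (Ck_open_pred _ _ _ HF)) as H'.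
    pose proof (is_derive_plus (V := R_NormedModule) _ _ _ _ _ H' H) as P.
    is_derive_by P.
    unfold plus; simpl; ring.
Qed.

(** * Taylor's theorem along two segments *)

Definition segment (A B : R * R) (th : R) : R * R :=
  (fst A + th * (fst B - fst A), snd A + th * (snd B - snd A)).

Definition two_segments (A m B w : R * R) : Prop :=
  exists th, 0 <= th <= 1 /\ (w = segment A m th \/ w = segment m B th).

Definition dist1 (A B : R * R) : R := Rabs (fst B - fst A) + Rabs (snd B - snd A).

(** Gateaux differentiability with gradient [(Gx, Gy)]: it holds for functions of
    class [C^1] and for Taylor polynomials alike. *)
Definition line_derivable (E : R * R -> Prop) (G Gx Gy : R * R -> R) : Prop :=
  forall z X Y, E z ->
    is_derive (fun th => G (fst z + th * X, snd z + th * Y)) 0 (X * Gx z + Y * Gy z).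

Lemma dist1_pos (A B : R * R) : 0 <= dist1 A B.
Proof. unfold dist1. pose proof (Rabs_pos (fst B - fst A)). pose proof (Rabs_pos (snd B - snd A)). lra. Qed.

(** The mean value theorem on the segment. *)
Lemma segment_bound (G Gx Gy : R * R -> R) (K : R) (A B : R * R) (th : R) :
  line_derivable (fun w => exists s, 0 <= s <= 1 /\ w = segment A B s) G Gx Gy ->
  (forall s, 0 <= s <= 1 ->
     Rabs (Gx (segment A B s)) <= K /\ Rabs (Gy (segment A B s)) <= K) ->
  0 <= th <= 1 -> Rabs (G (segment A B th) - G A) <= K * dist1 A B.
Proof.
  intros HD HK Hth.
  set (X := fst B - fst A). set (Y := snd B - snd A).
  assert (Hd : forall s, 0 <= s <= 1 -> is_derive (fun s => G (segment A B s)) s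
             (X * Gx (segment A B s) + Y * Gy (segment A B s))).
  { intros s Hs.
    apply (is_derive_ext (fun r => G (fst (segment A B s) + (r - s) * X, snd (segment A B s) + (r - s) * Y))).
    { intro r. unfold segment; simpl. fold X Y. f_equal. f_equal; ring. }
    pose proof (HD (segment A B s) X Y (ex_intro _ s (conj Hs eq_refl))) as H.
    replace 0 with (s - s) in H by ring.
    assert (Hs' : is_derive (fun r : R => r - s) s 1) by (auto_derive; auto; ring).
    pose proof (is_derive_comp (V := R_NormedModule) _ (fun r => r - s) s _ 1 H Hs') as P.
    is_derive_by P.
    exact (Rmult_1_l _). }
  destruct (MVT_gen (fun s => G (segment A B s)) 0 th
     (fun s => X * Gx (segment A B s) + Y * Gy (segment A B s))) as [c [Hc Ec]].
  - intros s Hs. rewrite Rmin_left, Rmax_right in Hs by lra. apply Hd. lra.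
  - intros s Hs. rewrite Rmin_left, Rmax_right in Hs by lra.
    apply continuity_pt_filterlim.
    apply (ex_derive_continuous (V := R_NormedModule) (fun s => G (segment A B s))). eexists. apply Hd; lra.
  - rewrite Rmin_left, Rmax_right in Hc by lra.
    assert (E0 : segment A B 0 = A) by (destruct A; unfold segment; simpl; f_equal; ring).
    rewrite E0 in Ec. rewrite Ec. replace (th - 0) with th by ring.
    destruct (HK c ltac:(lra)) as [K1 K2].
    pose proof (Rabs_pos X). pose proof (Rabs_pos Y).
    assert (K0 : 0 <= K) by (pose proof (Rabs_pos (Gx (segment A B c))); lra).
    rewrite Rabs_mult, (Rabs_right th) by lra.
    apply Rle_trans with (Rabs (X * Gx (segment A B c) + Y * Gy (segment A B c)) * 1).
    { apply Rmult_le_compat_l; [apply Rabs_pos | lra]. }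
    rewrite Rmult_1_r. eapply Rle_trans; [apply Rabs_triang|]. rewrite !Rabs_mult.
    unfold dist1. fold X Y. 
    replace (K * (Rabs X + Rabs Y)) with (Rabs X * K + Rabs Y * K) by ring.
    apply Rplus_le_compat; apply Rmult_le_compat_l; auto.
Qed.

Lemma two_segments_bound (G Gx Gy : R * R -> R) (K : R) (A m B : R * R) :
  line_derivable (two_segments A m B) G Gx Gy ->
  (forall w, two_segments A m B w -> Rabs (Gx w) <= K /\ Rabs (Gy w) <= K) ->
  G A = 0 ->
  forall w, two_segments A m B w -> Rabs (G w) <= K * (dist1 A m + dist1 m B).
Proof.
  intros HD HK GA w [th [Hth Hw]].
  assert (b1 : forall s, 0 <= s <= 1 -> Rabs (G (segment A m s) - G A) <= K * dist1 A m).
  { intros s Hs. apply (segment_bound G Gx Gy); auto.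
    - intros z X Y [r [Hr Er]]. apply HD. exists r; auto.
    - intros r Hr. apply HK. exists r; auto. }
  assert (b2 : forall s, 0 <= s <= 1 -> Rabs (G (segment m B s) - G m) <= K * dist1 m B).
  { intros s Hs. apply (segment_bound G Gx Gy); auto.
    - intros z X Y [r [Hr Er]]. apply HD. exists r; auto.
    - intros r Hr. apply HK. exists r; auto. }
  assert (K0 : 0 <= K).
  { destruct (HK w) as [K1 _]; [exists th; auto|]. pose proof (Rabs_pos (Gx w)); lra. }
  pose proof (Rmult_le_pos _ _ K0 (dist1_pos m B)).
  destruct Hw as [-> | ->].
  - specialize (b1 th Hth). rewrite GA, Rminus_0_r in b1. rewrite Rmult_plus_distr_l. lra.
  - specialize (b2 th Hth). specialize (b1 1 ltac:(lra)).
    assert (E1 : segment A m 1 = m) by (destruct m; unfold segment; simpl; f_equal; ring).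
    rewrite E1, GA, Rminus_0_r in b1.
    replace (G (segment m B th)) with ((G (segment m B th) - G m) + G m) by ring.
    eapply Rle_trans; [apply Rabs_triang|]. rewrite Rmult_plus_distr_l. lra.
Qed.

(** The bound concerns all derivatives of order exactly [k], in every order of
    differentiation. *)
Fixpoint order_bounded (k : nat) (E : R * R -> Prop) (K : R) (F : R * R -> R) : Prop :=
  match k with
  | O => forall z, E z -> Rabs (F z) <= K
  | S k' => order_bounded k' E K (dx F) /\ order_bounded k' E K (dy F)
  end.

Lemma order_bounded_mono (k : nat) (E E' : R * R -> Prop) (K K' : R) (F : R * R -> R) :
  (forall z, E' z -> E z) -> K <= K' -> order_bounded k E K F -> order_bounded k E' K' F.
Proof.
  intros HE HK. revert F. induction k as [|k IH]; intros F; simpl.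
  - intros H z Ez. apply Rle_trans with K; auto.
  - intros [H1 H2]; auto.
Qed.

Lemma taylor_zero (z : R * R) (k : nat) (F : R * R -> R) : taylor (at_point z) k F 0 0 = F z.
Proof.
  induction k as [|k IH].
  - unfold taylor. rewrite sum_O. reflexivity.
  - rewrite taylor_S, IH. simpl. unfold Rdiv. ring.
Qed.

(** Induction on the order: the gradient of the remainder of [F] of order [k + 1]
    is the pair of the remainders of [dx F] and [dy F] of order [k], bounded on
    the whole path by induction, and one more integration along the path gains
    one factor of its length. For this the estimate has to be stated for every
    point of the path and not only for its end. *)
Lemma taylor_two_segments (D : R * R -> Prop) (k : nat) (F : R * R -> R) (K : R) (A m B : R * R) :
  open D -> Ck_open (S k) D F ->
  (forall w, two_segments A m B w -> D w) ->
  order_bounded (S k) (two_segments A m B) K F ->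
  forall w, two_segments A m B w ->
  Rabs (F w - taylor (at_point A) k F (fst w - fst A) (snd w - snd A))
  <= K * (dist1 A m + dist1 m B) ^ (S k).
Proof.
  intros HD HF HE HB.
  assert (DA : D A).
  { apply HE. exists 0. split; [lra|]. left. destruct A; unfold segment; simpl; f_equal; ring. }
  revert F HF HB. induction k as [|k IH]; intros F HF HB w Hw.
  - rewrite pow_1. unfold taylor. rewrite sum_O. simpl hom. unfold at_point.
    apply (two_segments_bound (fun w => F w - F A) (dx F) (dy F) K); auto.
    + intros z X Y Ez. 
      pose proof (line_derivative D F z X Y HD HF (HE z Ez)) as P.
      pose proof (is_derive_minus (V := R_NormedModule) _ (fun _ => F A) 0 _ _ P
        (is_derive_const (V := R_NormedModule) (F A) 0)) as Q.
      is_derive_by Q.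
      exact (Rminus_0_r _).
    + intros z Ez. destruct HB as [B1 B2]. split; [apply B1 | apply B2]; auto.
    + ring.
  - set (L := dist1 A m + dist1 m B) in *.
    replace (K * L ^ S (S k)) with (K * L ^ S k * L) by (simpl; ring).
    apply (two_segments_bound
      (fun w => F w - taylor (at_point A) (S k) F (fst w - fst A) (snd w - snd A))
      (fun w => dx F w - taylor (at_point A) k (dx F) (fst w - fst A) (snd w - snd A))
      (fun w => dy F w - taylor (at_point A) k (dy F) (fst w - fst A) (snd w - snd A))); auto.
    + intros z X Y Ez.
      assert (HF1 : Ck_open 1 D F) by (apply (Ck_open_le 1 (S (S k))); auto; lia).
      pose proof (line_derivative D F z X Y HD HF1 (HE z Ez)) as P.
      pose proof (taylor_line_derivative D k F A (fst z - fst A) (snd z - snd A) X Y HD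
         (Ck_open_pred _ _ _ HF) DA) as Q.
      pose proof (is_derive_minus (V := R_NormedModule) _ _ _ _ _ P Q) as S.
      match type of S with is_derive _ _ ?l =>
        match goal with |- is_derive _ _ ?r => replace r with l end end.
      * eapply is_derive_ext; [|exact S]. intro t. cbv beta. unfold minus, plus, opp; simpl fst; simpl snd; simpl.
        unfold Rminus. f_equal. f_equal. f_equal; ring.
      * unfold minus, plus, opp; simpl. ring.
    + intros z Ez. destruct HB as [B1 B2]. split.
      * apply IH; auto. exact (Ck_open_pd _ _ _ true HF).
      * apply IH; auto. exact (Ck_open_pd _ _ _ false HF).
    + unfold Rminus. rewrite !Rplus_opp_r, taylor_zero. ring.
Qed.

(** * Connecting points near the boundary *)

Lemma lipschitz_near (f : R -> R) (r : R) :
  0 < r -> (forall s, Rabs s < r -> ex_derive f s) -> continuous (Derive f) 0 ->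
  exists P r1, 0 <= P /\ 0 < r1 <= r /\
    forall s s', Rabs s < r1 -> Rabs s' < r1 -> Rabs (f s - f s') <= P * Rabs (s - s').
Proof.
  intros Hr Hd Hc.
  destruct (Hc (ball (Derive f 0) (mkposreal 1 Rlt_0_1))) as [d Hd1].
  { exists (mkposreal 1 Rlt_0_1). auto. }
  exists (Rabs (Derive f 0) + 1), (Rmin d r).
  pose proof (Rabs_pos (Derive f 0)). 
  split; [lra|]. split.
  { split; [apply Rmin_pos; auto; apply cond_pos | apply Rmin_r]. }
  intros s s' Hs Hs'.
  assert (near : forall x, Rmin s' s <= x <= Rmax s' s -> Rabs x < Rmin d r).
  { intros x Hx. apply Rabs_def2 in Hs. apply Rabs_def2 in Hs'.
    unfold Rmin at 1, Rmax in Hx. destruct (Rle_dec s' s); apply Rabs_def1; lra. }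
  pose proof (Rmin_l d r). pose proof (Rmin_r d r).
  destruct (MVT_gen f s' s (Derive f)) as [c [Hc1 Ec]].
  - intros x Hx. apply Derive_correct, Hd. pose proof (near x ltac:(lra)). lra.
  - intros x Hx. apply continuity_pt_filterlim.
    apply (ex_derive_continuous (V := R_NormedModule) f). apply Hd. pose proof (near x Hx). lra.
  - rewrite Ec, Rabs_mult. apply Rmult_le_compat_r; [apply Rabs_pos|].
    pose proof (near c Hc1) as Nc.
    assert (Bc : Rabs (Derive f c - Derive f 0) < 1).
    { apply (Hd1 c). unfold ball; simpl. unfold AbsRing_ball, abs, minus, plus, opp; simpl.
      rewrite Ropp_0, Rplus_0_r. lra. }
    replace (Derive f c) with ((Derive f c - Derive f 0) + Derive f 0) by ring.
    eapply Rle_trans; [apply Rabs_triang|]. lra.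
Qed.

Lemma ball_pair (z z' : R * R) (eps : R) :
  ball z eps z' <-> Rabs (fst z' - fst z) < eps /\ Rabs (snd z' - snd z) < eps.
Proof. split; intros H; exact H. Qed.

Lemma Rabs_combination (a b x y M : R) :
  Rabs a <= 1 -> Rabs b <= 1 -> Rabs x <= M -> Rabs y <= M -> Rabs (a * x + b * y) <= 2 * M.
Proof.
  intros Ha Hb Hx Hy. eapply Rle_trans; [apply Rabs_triang|]. rewrite !Rabs_mult.
  pose proof (Rabs_pos a). pose proof (Rabs_pos b). pose proof (Rabs_pos x). pose proof (Rabs_pos y).
  nra.
Qed.

Lemma Rabs_convex (a b th M : R) :
  0 <= th <= 1 -> Rabs a < M -> Rabs b < M -> Rabs (a + th * (b - a)) < M.
Proof.
  intros Hth Ha Hb. apply Rabs_def2 in Ha. apply Rabs_def2 in Hb.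
  assert (Rmin a b <= a + th * (b - a) <= Rmax a b).
  { unfold Rmin, Rmax. destruct (Rle_dec a b); split; nra. }
  pose proof (Rmin_glb_lt a b (- M)). pose proof (Rmax_lub_lt a b M).
  apply Rabs_def1; lra.
Qed.

Lemma segment_in_box (z0 A B : R * R) (M th : R) :
  0 <= th <= 1 ->
  Rabs (fst A - fst z0) < M /\ Rabs (snd A - snd z0) < M ->
  Rabs (fst B - fst z0) < M /\ Rabs (snd B - snd z0) < M ->
  Rabs (fst (segment A B th) - fst z0) < M /\ Rabs (snd (segment A B th) - snd z0) < M.
Proof.
  intros Hth [A1 A2] [B1 B2]. unfold segment; simpl. split.
  - replace (fst A + th * (fst B - fst A) - fst z0)
      with ((fst A - fst z0) + th * ((fst B - fst z0) - (fst A - fst z0))) by ring.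
    apply Rabs_convex; auto.
  - replace (snd A + th * (snd B - snd A) - snd z0)
      with ((snd A - snd z0) + th * ((snd B - snd z0) - (snd A - snd z0))) by ring.
    apply Rabs_convex; auto.
Qed.

(** In the chart, the boundary is the graph of a function of slope at most [P].
    Going straight up from [A] by a height [H] larger than the variation of the
    graph between the two points leads to a point [m] from which [B] is reached
    along a segment steeper than the graph. Both segments stay in the epigraph,
    and their length is of the order of the distance from [A] to [B]. *)
Lemma boundary_quasiconvex (Om : R * R -> Prop) (z0 : R * R) :
  smooth_boundary Om -> frontier Om z0 ->
  exists L, 0 <= L /\ forall eps, 0 < eps -> exists delta, 0 < delta /\
    forall A B rho, Om A -> Om B -> ball z0 delta A -> ball z0 delta B -> 0 < rho <= delta ->
      Rabs (fst B - fst A) <= rho -> Rabs (snd B - snd A) <= rho ->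
      exists m, (forall w, two_segments A m B w -> Om w /\ ball z0 eps w) /\
        dist1 A m + dist1 m B <= L * rho.
Proof.
  intros HS Hz0. destruct (HS z0 Hz0) as (e1 & e2 & r & psi & He & Hr & Hpsi0 & Hpsi & Hchart).
  destruct (lipschitz_near psi r) as (P & r1 & HP & Hr1 & Hlip); auto.
  { intros s Hs. apply (Hpsi 1%nat s); auto. }
  { apply (Hpsi 1%nat 0); auto. rewrite Rabs_R0; auto. }
  assert (He1 : Rabs e1 <= 1) by (apply Rabs_le; nra).
  assert (He2 : Rabs e2 <= 1) by (apply Rabs_le; nra).
  assert (He2' : Rabs (- e2) <= 1) by (rewrite Rabs_Ropp; auto).
  set (s := fun z : R * R => e1 * (fst z - fst z0) + e2 * (snd z - snd z0)).
  set (y := fun z : R * R => - e2 * (fst z - fst z0) + e1 * (snd z - snd z0)).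
  assert (chart : forall z, Rabs (s z) < r -> Rabs (y z) < r -> (Om z <-> psi (s z) < y z)).
  { intros z Hs Hy. pose proof (Hchart (s z) (y z) Hs Hy : Om (fst z0 + s z * e1 - y z * e2, snd z0 + s z * e2 + y z * e1)
      <-> psi (s z) < y z) as C.
    assert (Ez : (fst z0 + s z * e1 - y z * e2, snd z0 + s z * e2 + y z * e1) = z).
    { destruct z as [a b]; unfold s, y; simpl. f_equal.
      - transitivity (fst z0 + (e1 ^ 2 + e2 ^ 2) * (a - fst z0)); [ring | rewrite He; ring].
      - transitivity (snd z0 + (e1 ^ 2 + e2 ^ 2) * (b - snd z0)); [ring | rewrite He; ring]. }
    rewrite Ez in C. exact C. }
  (* With [H = (2 P + 3) rho] below, the two segments have total length at most
     [4 H + 2 rho]. *)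
  exists (8 * P + 14). split; [lra|]. intros eps Heps.
  (* The path stays within [delta + H <= (2 P + 4) delta] of [z0]; the factor
     [1 / 2] in [r1 / 2] pays for the rotation of the coordinates. *)
  set (delta := Rmin eps (r1 / 2) / (2 * P + 4)).
  assert (Hdelta : 0 < delta) by (apply Rdiv_lt_0_compat; [apply Rmin_pos; lra | lra]).
  assert (Ed : (2 * P + 4) * delta = Rmin eps (r1 / 2)) by (unfold delta; field; lra).
  pose proof (Rmin_l eps (r1 / 2)) as Hmin1. pose proof (Rmin_r eps (r1 / 2)) as Hmin2.
  assert (coords : forall z M, Rabs (fst z - fst z0) < M -> Rabs (snd z - snd z0) < M -> 2 * M <= r1 ->
            Rabs (s z) < r1 /\ Rabs (y z) < r1).
  { intros z M H1 H2 HM.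
    set (M' := Rmax (Rabs (fst z - fst z0)) (Rabs (snd z - snd z0))).
    assert (M' < M) by (apply Rmax_lub_lt; auto).
    pose proof (Rabs_combination e1 e2 _ _ M' He1 He2 (Rmax_l _ _) (Rmax_r _ _)).
    pose proof (Rabs_combination (- e2) e1 _ _ M' He2' He1 (Rmax_l _ _) (Rmax_r _ _)).
    unfold s, y. split; lra. }
  exists delta. split; auto. intros A B rho OA OB BA BB [Hrho Hrd] HX HY.
  (* The rotated coordinates of [A] and [B] differ by at most [2 rho], so the
     graph rises by at most [2 P rho] and [B] lies at most [2 rho] above [A]. *)
  set (H := (2 * P + 3) * rho).
  assert (HH : 0 < H) by (unfold H; nra).
  assert (HHd : H <= (2 * P + 3) * delta) by (unfold H; nra).
  set (m := (fst A - e2 * H, snd A + e1 * H)).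
  apply (proj1 (ball_pair _ _ _)) in BA. apply (proj1 (ball_pair _ _ _)) in BB. destruct BA as [BA1 BA2], BB as [BB1 BB2].
  assert (He1H : Rabs (e1 * H) <= H).
  { rewrite Rabs_mult, (Rabs_right H) by lra. nra. }
  assert (He2H : Rabs (e2 * H) <= H).
  { rewrite Rabs_mult, (Rabs_right H) by lra. nra. }
  set (M := delta + H).
  assert (HM : M <= Rmin eps (r1 / 2)) by (unfold M; rewrite <- Ed; nra).
  assert (Hm : Rabs (fst m - fst z0) < M /\ Rabs (snd m - snd z0) < M).
  { unfold M, m; simpl. split.
    - replace (fst A - e2 * H - fst z0) with ((fst A - fst z0) + - (e2 * H)) by ring.
      eapply Rle_lt_trans; [apply Rabs_triang|]. rewrite Rabs_Ropp. lra.
    - replace (snd A + e1 * H - snd z0) with ((snd A - snd z0) + (e1 * H)) by ring.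
      eapply Rle_lt_trans; [apply Rabs_triang|]. lra. }
  assert (HAM : Rabs (fst A - fst z0) < M /\ Rabs (snd A - snd z0) < M) by (unfold M; lra).
  assert (HBM : Rabs (fst B - fst z0) < M /\ Rabs (snd B - snd z0) < M) by (unfold M; lra).
  assert (inM : forall w, two_segments A m B w -> Rabs (fst w - fst z0) < M /\ Rabs (snd w - snd z0) < M).
  { intros w (th & Hth & [-> | ->]); apply segment_in_box; auto. }
  assert (inr : forall w, Rabs (fst w - fst z0) < M /\ Rabs (snd w - snd z0) < M ->
            Rabs (s w) < r1 /\ Rabs (y w) < r1).
  { intros w [W1 W2]. apply (coords w M); auto. lra. }
  destruct (inr A HAM) as [sA yA]. destruct (inr B HBM) as [sB yB].
  assert (PA : psi (s A) < y A) by (apply chart; auto; lra).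
  assert (PB : psi (s B) < y B) by (apply chart; auto; lra).
  assert (Hs : Rabs (s A - s B) <= 2 * rho).
  { rewrite Rabs_minus_sym. replace (s B - s A) with (e1 * (fst B - fst A) + e2 * (snd B - snd A)) by (unfold s; ring).
    apply Rabs_combination; auto. }
  assert (Hy : Rabs (y B - y A) <= 2 * rho).
  { replace (y B - y A) with (- e2 * (fst B - fst A) + e1 * (snd B - snd A)) by (unfold y; ring).
    apply Rabs_combination; auto. }
  apply Rabs_le_between in Hy.
  exists m. split.
  - intros w Hw. pose proof (inM w Hw) as Mw. split.
    2: { apply (proj2 (ball_pair _ _ _)). split; lra. }
    destruct (inr w Mw) as [sw yw]. apply chart; try lra.
    destruct Hw as (th & Hth & [-> | ->]).
    + replace (s (segment A m th)) with (s A) by (unfold s, segment, m; simpl; ring).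
      replace (y (segment A m th)) with (y A + th * ((e1 ^ 2 + e2 ^ 2) * H)) by (unfold y, segment, m; simpl; ring).
      rewrite He. nra.
    + assert (sm : s (segment m B th) - s B = (1 - th) * (s A - s B)) by (unfold s, segment, m; simpl; ring).
      assert (ym : y (segment m B th) = th * y B + (1 - th) * (y A + (e1 ^ 2 + e2 ^ 2) * H))
        by (unfold y, segment, m; simpl; ring).
      rewrite He in ym.
      pose proof (Hlip _ _ sw sB) as Lw. rewrite sm, Rabs_mult, (Rabs_right (1 - th)) in Lw by lra.
      apply Rabs_le_between in Lw.
      assert (P * ((1 - th) * Rabs (s A - s B)) <= P * ((1 - th) * (2 * rho))).
      { apply Rmult_le_compat_l; auto. apply Rmult_le_compat_l; lra. }
      assert ((1 - th) * (y B + (2 * P + 1) * rho) <= (1 - th) * (y A + 1 * H)).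
      { apply Rmult_le_compat_l; [lra|]. unfold H. lra. }
      rewrite ym.
      assert (0 <= (1 - th) * rho) by nra.
      nra.
  - assert (D1 : dist1 A m <= 2 * H).
    { unfold dist1, m; simpl.
      replace (fst A - e2 * H - fst A) with (- (e2 * H)) by ring.
      replace (snd A + e1 * H - snd A) with (e1 * H) by ring.
      rewrite Rabs_Ropp. lra. }
    assert (D2 : dist1 m B <= 2 * H + 2 * rho).
    { unfold dist1, m; simpl.
      replace (fst B - (fst A - e2 * H)) with ((fst B - fst A) + (e2 * H)) by ring.
      replace (snd B - (snd A + e1 * H)) with ((snd B - snd A) + - (e1 * H)) by ring.
      pose proof (Rabs_triang (fst B - fst A) (e2 * H)).
      pose proof (Rabs_triang (snd B - snd A) (- (e1 * H))) as T. rewrite Rabs_Ropp in T. lra. }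
    unfold H in *. lra.
Qed.

(** * Taylor's theorem up to the boundary *)

Lemma ucont_locally_bounded (D : R * R -> Prop) (F : R * R -> R) (z : R * R) :
  ucont_on D F -> closure D z ->
  exists eps K, 0 < eps /\ 0 <= K /\ forall w, D w -> ball z eps w -> Rabs (F w) <= K.
Proof.
  intros HF Hz.
  destruct (ucont_converges D F z HF Hz (ball (trace D F z) (mkposreal 1 Rlt_0_1))) as [r Hr].
  { exists (mkposreal 1 Rlt_0_1). auto. }
  exists r, (Rabs (trace D F z) + 1). split; [apply cond_pos|]. split.
  { pose proof (Rabs_pos (trace D F z)). lra. }
  intros w Dw Bw. pose proof (Hr w Bw Dw : Rabs (F w - trace D F z) < 1) as H.
  replace (F w) with ((F w - trace D F z) + trace D F z) by ring.
  eapply Rle_trans; [apply Rabs_triang|]. lra.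
Qed.

Lemma order_bounded_near (k : nat) (D : R * R -> Prop) (F : R * R -> R) (z : R * R) :
  Ck_open k D F -> closure D z ->
  exists eps K, 0 < eps /\ 0 <= K /\ order_bounded k (fun w => D w /\ ball z eps w) K F.
Proof.
  intros HF Hz. revert F HF. induction k as [|k IH]; intros F HF.
  - destruct (ucont_locally_bounded D F z (Ck_open_ucont _ _ _ HF) Hz) as (eps & K & He & HK & H).
    exists eps, K. repeat split; auto. intros w [Dw Bw]. auto.
  - destruct (IH _ (Ck_open_pd _ _ _ true HF)) as (e1 & K1 & He1 & HK1 & B1).
    destruct (IH _ (Ck_open_pd _ _ _ false HF)) as (e2 & K2 & He2 & HK2 & B2).
    exists (Rmin e1 e2), (Rmax K1 K2). split; [apply Rmin_pos; auto|]. split.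
    { apply Rle_trans with K1; auto. apply Rmax_l. }
    split.
    + eapply order_bounded_mono; [|apply Rmax_l|exact B1].
      intros w [Dw Bw]. split; auto. eapply ball_le; [|exact Bw]. apply Rmin_l.
    + eapply order_bounded_mono; [|apply Rmax_r|exact B2].
      intros w [Dw Bw]. split; auto. eapply ball_le; [|exact Bw]. apply Rmin_r.
Qed.

Lemma taylor_inside (Om : R * R -> Prop) (k : nat) (F : R * R -> R) (z0 : R * R) :
  open Om -> smooth_boundary Om -> Ck_open (S k) Om F -> frontier Om z0 ->
  exists delta K, 0 < delta /\ 0 <= K /\
    forall A B rho, Om A -> Om B -> ball z0 delta A -> ball z0 delta B -> 0 < rho <= delta ->
      Rabs (fst B - fst A) <= rho -> Rabs (snd B - snd A) <= rho ->
      Rabs (F B - taylor (at_point A) k F (fst B - fst A) (snd B - snd A)) <= K * rho ^ (S k).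
Proof.
  intros HO HS HF Hz.
  destruct (order_bounded_near (S k) Om F z0 HF (proj1 Hz)) as (eps & K & He & HK & HB).
  destruct (boundary_quasiconvex Om z0 HS Hz) as (L & HL & Hq).
  destruct (Hq eps He) as (delta & Hd & Hpath).
  exists delta, (K * L ^ (S k)). split; auto. split.
  { apply Rmult_le_pos; auto. apply pow_le; auto. }
  intros A B rho OA OB BA BB Hrho HX HY.
  destruct (Hpath A B rho OA OB BA BB Hrho HX HY) as (m & Hm & Hlen).
  eapply Rle_trans.
  - apply (taylor_two_segments Om k F K A m B); auto.
    + intros w Hw. apply Hm, Hw.
    + eapply order_bounded_mono; [|apply Rle_refl|exact HB]. exact Hm.
    + exists 1. split; [lra|]. right. destruct B; unfold segment; simpl; f_equal; ring.
  - rewrite Rmult_assoc, <- Rpow_mult_distr. apply Rmult_le_compat_l; auto.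
    apply pow_incr. split; auto. pose proof (dist1_pos A m). pose proof (dist1_pos m B). lra.
Qed.

Definition trace_at (D : R * R -> Prop) (z : R * R) (F : R * R -> R) : R := trace D F z.

Lemma hom_limit {T : Type} (Fl : (T -> Prop) -> Prop) {FF : Filter Fl} (D : R * R -> Prop)
    (j : nat) (F : R * R -> R) (z : R * R) (A : T -> R * R) (X Y : T -> R) (x y : R) :
  Ck_open j D F -> closure D z ->
  filterlim A Fl (within D (locally z)) ->
  filterlim X Fl (locally x) -> filterlim Y Fl (locally y) ->
  filterlim (fun s => hom (at_point (A s)) j F (X s) (Y s)) Fl
    (locally (hom (trace_at D z) j F x y)).
Proof.
  intros HF Hz HA HX HY. revert F HF. induction j as [|j IH]; intros F HF.
  - simpl. eapply filterlim_comp; [exact HA|].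
    apply ucont_converges; auto. apply (Ck_open_ucont _ _ _ HF).
  - simpl hom. apply lim_mult; auto.
    + apply lim_plus; auto.
      * apply lim_mult; auto. apply IH. exact (Ck_open_pd _ _ _ true HF).
      * apply lim_mult; auto. apply IH. exact (Ck_open_pd _ _ _ false HF).
    + apply (filterlim_const (U := R_UniformSpace)).
Qed.

Lemma taylor_limit {T : Type} (Fl : (T -> Prop) -> Prop) {FF : Filter Fl} (D : R * R -> Prop)
    (k : nat) (F : R * R -> R) (z : R * R) (A : T -> R * R) (X Y : T -> R) (x y : R) :
  Ck_open k D F -> closure D z ->
  filterlim A Fl (within D (locally z)) ->
  filterlim X Fl (locally x) -> filterlim Y Fl (locally y) ->
  filterlim (fun s => taylor (at_point (A s)) k F (X s) (Y s)) Fl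
    (locally (taylor (trace_at D z) k F x y)).
Proof.
  intros HF Hz HA HX HY. induction k as [|k IH].
  - unfold taylor. rewrite sum_O.
    eapply filterlim_ext; [|exact (hom_limit Fl D 0 F z A X Y x y HF Hz HA HX HY)].
    intro s. rewrite sum_O. reflexivity.
  - rewrite taylor_S.
    apply (filterlim_ext (fun s => taylor (at_point (A s)) k F (X s) (Y s)
                                   + hom (at_point (A s)) (S k) F (X s) (Y s))).
    { intro s. rewrite taylor_S. reflexivity. }
    apply lim_plus; auto.
    + apply IH, Ck_open_pred, HF.
    + apply (hom_limit Fl D (S k)); auto.
Qed.

Lemma fst_limit (z : R * R) : filterlim fst (locally z) (locally (fst z)).
Proof. intros P [e He]. exists e. intros y [B1 B2]. apply He, B1. Qed.

Lemma snd_limit (z : R * R) : filterlim snd (locally z) (locally (snd z)).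
Proof. intros P [e He]. exists e. intros y [B1 B2]. apply He, B2. Qed.

Lemma within_le {X : UniformSpace} (D : X -> Prop) (z : X) :
  filterlim (fun x => x) (within D (locally z)) (locally z).
Proof. intros P HP. unfold filtermap, within. revert HP. apply filter_imp; auto. Qed.

(** The estimate inside the domain passes to the limit when both points tend to
    points of the closure: the value becomes the trace, and the coefficients of
    the polynomial become the traces of the derivatives. *)
Lemma taylor_boundary (Om : R * R -> Prop) (k : nat) (F : R * R -> R) (z0 : R * R) :
  open Om -> smooth_boundary Om -> Ck_open (S k) Om F -> frontier Om z0 ->
  exists delta K, 0 < delta /\ 0 <= K /\
    forall (z1 z2 : R * R) (rho : R), closure Om z1 -> closure Om z2 ->
      ball z0 delta z1 -> ball z0 delta z2 -> 0 < rho <= delta ->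
      Rabs (fst z2 - fst z1) <= rho -> Rabs (snd z2 - snd z1) <= rho ->
      Rabs (trace Om F z2 - taylor (trace_at Om z1) k F (fst z2 - fst z1) (snd z2 - snd z1))
      <= K * rho ^ (S k).
Proof.
  intros HO HS HF Hz.
  destruct (taylor_inside Om k F z0 HO HS HF Hz) as (delta & K & Hd & HK & HT).
  exists (delta / 2), (K * 2 ^ (S k)). split; [lra|]. split.
  { apply Rmult_le_pos; auto. apply pow_le; lra. }
  intros z1 z2 rho C1 C2 B1 B2 Hrho HX HY.
  pose proof (within_closure_proper Om z1 C1) as P1.
  pose proof (within_closure_proper Om z2 C2) as P2.
  pose proof (filter_prod_proper (F := within Om (locally z1)) (G := within Om (locally z2))) as PF.
  apply (lim_le (filter_prod (within Om (locally z1)) (within Om (locally z2)))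
    (fun AB => Rabs (F (snd AB) - taylor (at_point (fst AB)) k F
       (fst (snd AB) - fst (fst AB)) (snd (snd AB) - snd (fst AB))))).
  - apply lim_abs. apply lim_plus; [apply filter_filter| |apply lim_opp].
    + eapply filterlim_comp; [apply filterlim_snd|].
      apply ucont_converges; auto. apply (Ck_open_ucont _ _ _ HF).
    + assert (l1 : filterlim fst (filter_prod (within Om (locally z1)) (within Om (locally z2))) (locally z1)).
      { exact (filterlim_comp _ _ _ fst (fun z => z) _ _ _ filterlim_fst (within_le Om z1)). }
      assert (l2 : filterlim snd (filter_prod (within Om (locally z1)) (within Om (locally z2))) (locally z2)).
      { exact (filterlim_comp _ _ _ snd (fun z => z) _ _ _ filterlim_snd (within_le Om z2)). }
      apply (taylor_limit (filter_prod (within Om (locally z1)) (within Om (locally z2))) Om k F z1 fst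
        (fun AB => fst (snd AB) - fst (fst AB)) (fun AB => snd (snd AB) - snd (fst AB))); auto.
      * apply Ck_open_pred, HF.
      * apply filterlim_fst.
      * apply lim_plus; [apply filter_filter| |apply lim_opp].
        -- eapply filterlim_comp; [exact l2|apply fst_limit].
        -- eapply filterlim_comp; [exact l1|apply fst_limit].
      * apply lim_plus; [apply filter_filter| |apply lim_opp].
        -- eapply filterlim_comp; [exact l2|apply snd_limit].
        -- eapply filterlim_comp; [exact l1|apply snd_limit].
  - assert (He : 0 < Rmin (delta / 2) (rho / 2)) by (apply Rmin_pos; lra).
    set (e := mkposreal _ He).
    assert (Ee : e <= delta / 2 /\ e <= rho / 2) by (split; [apply Rmin_l | apply Rmin_r]).
    clearbody e.
    apply (Filter_prod _ _ _ (fun A => Om A /\ ball z1 e A) (fun B => Om B /\ ball z2 e B)).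
    + exists e. auto.
    + exists e. auto.
    + intros A B [OA BA] [OB BB]. 
        (* Nearby inner points may be slightly farther apart than [rho], whence the
           estimate is used at distance [2 rho]. *)
        change (Rabs (F B - taylor (at_point A) k F (fst B - fst A) (snd B - snd A))
                <= K * 2 ^ S k * rho ^ S k).
      rewrite Rmult_assoc, <- Rpow_mult_distr.
      apply (HT A B (2 * rho)); auto; try lra.
      * apply ball_le with (delta / 2 + e); [lra|]. apply ball_triangle with z1; auto.
      * apply ball_le with (delta / 2 + e); [lra|]. apply ball_triangle with z2; auto.
      * apply (proj1 (ball_pair _ _ _)) in BA. apply (proj1 (ball_pair _ _ _)) in BB.
        destruct BA as [BA _], BB as [BB _].
        apply Rabs_def2 in BA. apply Rabs_def2 in BB. apply Rabs_le_between in HX.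
        apply Rabs_le. lra.
      * apply (proj1 (ball_pair _ _ _)) in BA. apply (proj1 (ball_pair _ _ _)) in BB.
        destruct BA as [_ BA], BB as [_ BB].
        apply Rabs_def2 in BA. apply Rabs_def2 in BB. apply Rabs_le_between in HY.
        apply Rabs_le. lra.
Qed.

Lemma hom_bounded_near (Om : R * R -> Prop) (j : nat) (F : R * R -> R) (z0 : R * R) (C : R) :
  Ck_open j Om F -> closure Om z0 -> 0 <= C ->
  exists delta K, 0 < delta /\ 0 <= K /\
    forall (z1 : R * R) (x y : R), closure Om z1 -> ball z0 delta z1 -> Rabs x <= C -> Rabs y <= C ->
      Rabs (hom (trace_at Om z1) j F x y) <= K.
Proof.
  intros HF Hz HC. revert F HF. induction j as [|j IH]; intros F HF.
  - destruct (ucont_locally_bounded Om F z0 (Ck_open_ucont _ _ _ HF) Hz) as (eps & K & He & HK & H).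
    exists (eps / 2), K. split; [lra|]. split; auto. intros z1 x y C1 B1 _ _. simpl.
    pose proof (within_closure_proper Om z1 C1) as P1.
    apply (lim_le (within Om (locally z1)) (fun w => Rabs (F w))).
    + apply lim_abs. apply ucont_converges; auto. apply (Ck_open_ucont _ _ _ HF).
    + assert (He2 : 0 < eps / 2) by lra. exists (mkposreal _ He2). intros w Bw Ow.
      apply H; auto. replace eps with (eps / 2 + eps / 2) by lra.
      apply ball_triangle with z1; auto.
  - destruct (IH _ (Ck_open_pd _ _ _ true HF)) as (e1 & K1 & He1 & HK1 & B1).
    destruct (IH _ (Ck_open_pd _ _ _ false HF)) as (e2 & K2 & He2 & HK2 & B2).
    exists (Rmin e1 e2), (C * K1 + C * K2). split; [apply Rmin_pos; auto|]. split; [nra|].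
    intros z1 x y C1 Bz Hx Hy. simpl hom.
    assert (I1 : 1 <= INR (S j)) by (apply (le_INR 1); lia).
    change (match j with O => 1 | S _ => INR j + 1 end) with (INR (S j)).
    unfold Rdiv. rewrite Rabs_mult, (Rabs_right (/ INR (S j))).
    2: { left. apply Rinv_0_lt_compat; lra. }
    assert (I2 : / INR (S j) <= 1) by (rewrite <- Rinv_1; apply Rinv_le_contravar; lra).
    assert (I3 : 0 < / INR (S j)) by (apply Rinv_0_lt_compat; lra).
    assert (T1 : Rabs (x * hom (trace_at Om z1) j (dx F) x y) <= C * K1).
    { rewrite Rabs_mult. apply Rmult_le_compat; try apply Rabs_pos; auto.
      apply B1; auto. eapply ball_le; [|exact Bz]. apply Rmin_l. }
    assert (T2 : Rabs (y * hom (trace_at Om z1) j (dy F) x y) <= C * K2).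
    { rewrite Rabs_mult. apply Rmult_le_compat; try apply Rabs_pos; auto.
      apply B2; auto. eapply ball_le; [|exact Bz]. apply Rmin_r. }
    match goal with |- Rabs ?s * _ <= _ => pose proof (Rabs_pos s); 
       assert (Rabs s <= C * K1 + C * K2) by (eapply Rle_trans; [apply Rabs_triang|]; lra) end.
    nra.
Qed.

Lemma frontier_closed (Om : R * R -> Prop) (z : R * R) :
  ~ frontier Om z -> exists delta, 0 < delta /\ forall z', ball z delta z' -> ~ frontier Om z'.
Proof.
  intros Hz.
  assert (cl : forall D : R * R -> Prop, ~ closure D z ->
     exists delta, 0 < delta /\ forall z', ball z delta z' -> ~ closure D z').
  { intros D HD. apply not_all_ex_not in HD. destruct HD as [eps He].
    exists (eps / 2). pose proof (cond_pos eps). split; [lra|]. intros z' Bz' C.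
    assert (H2 : 0 < eps / 2) by lra.
    destruct (C (mkposreal _ H2)) as [w [Dw Bw]]. apply He. exists w. split; auto.
    replace (pos eps) with (eps / 2 + eps / 2) by lra. apply ball_triangle with z'; auto. }
  apply not_and_or in Hz. destruct Hz as [H|H]; destruct (cl _ H) as (d & Hd & Hn);
    exists d; split; auto; intros z' B [F1 F2]; apply (Hn z' B); auto.
Qed.

(** Compactness of a square, in the form of a number [d] such that every point of
    the square is within reach of a point whose radius is at least [d]. Off the
    frontier, which is closed, a ball missing it makes the claim void. *)
Lemma uniform_on_frontier (Om : R * R -> Prop) (Q : R -> R * R -> Prop) (rho : R) :
  (forall d d' z, 0 < d' <= d -> Q d z -> Q d' z) ->
  (forall z0, frontier Om z0 -> exists delta, 0 < delta /\
     forall z, frontier Om z -> ball z0 delta z -> Q delta z) ->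
  exists delta, 0 < delta /\
    forall z, frontier Om z -> Rabs (fst z) <= rho -> Rabs (snd z) <= rho -> Q delta z.
Proof.
  intros Hmono Hloc.
  assert (H : forall u v, { delta : posreal |
    forall z, frontier Om z -> ball (u, v) delta z -> Q delta z }).
  { intros u v. apply constructive_indefinite_description.
    destruct (classic (frontier Om (u, v))) as [Hf | Hf].
    - destruct (Hloc _ Hf) as (d & Hd & H). exists (mkposreal d Hd). exact H.
    - destruct (frontier_closed Om _ Hf) as (d & Hd & H). exists (mkposreal d Hd).
      intros z Fz Bz. exfalso. exact (H z Bz Fz). }
  destruct (compactness_value_2d (- rho) rho (- rho) rho (fun u v => proj1_sig (H u v))) as [d Hd].
  exists d. split; [apply cond_pos|]. intros z Fz H1 H2.
  apply Rabs_le_between in H1. apply Rabs_le_between in H2.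
  destruct (NNPP _ (Hd (fst z) (snd z) H1 H2)) as (u & v & _ & _ & D1 & D2 & D3).
  apply (Hmono (proj1_sig (H u v))).
  - split; auto. apply cond_pos.
  - destruct (H u v) as [delta Hdelta]; simpl in *. apply Hdelta; auto.
    apply (proj2 (ball_pair _ _ _)); auto.
Qed.

(** * The equation at the boundary *)

(** What the coefficients of the reduced equation inherit from the data: the
    derivatives are only required to have limits at the boundary, so that the
    class is stable under quotients without estimates. *)
Definition C1_upto_boundary (D : R * R -> Prop) (F : R * R -> R) : Prop :=
  (forall b z, D z -> pdable b F z) /\
  (forall z, closure D z -> converges D F z /\ forall b, converges D (pd b F) z).

Lemma Ck_open_C1 (k : nat) (D : R * R -> Prop) (F : R * R -> R) :
  Ck_open (S k) D F -> C1_upto_boundary D F.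
Proof.
  intros HF. split.
  - intros b z Dz. exact (Ck_open_pdable _ _ _ b z HF Dz).
  - intros z Cz. split.
    + apply ucont_converges; auto. apply (Ck_open_ucont _ _ _ HF).
    + intro b. apply ucont_converges; auto. apply (Ck_open_ucont _ _ _ (Ck_open_pd _ _ _ b HF)).
Qed.

Lemma C1_opp (D : R * R -> Prop) (F : R * R -> R) :
  C1_upto_boundary D F -> C1_upto_boundary D (fun z => - F z).
Proof.
  intros [F1 F2]. split.
  - intros b z Dz. apply pd_opp; auto.
  - intros z Cz. destruct (F2 z Cz) as [H1 H2]. split.
    + apply (converges_to D _ z _ Cz (lim_opp _ _ _ H1)).
    + intro b. apply (converges_ext D (fun z => - pd b F z)); auto.
      * intros z' Dz'. symmetry. apply pd_opp; auto.
      * apply (converges_to D _ z _ Cz (lim_opp _ _ _ (H2 b))).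
Qed.

Lemma C1_plus (D : R * R -> Prop) (F G : R * R -> R) :
  C1_upto_boundary D F -> C1_upto_boundary D G -> C1_upto_boundary D (fun z => F z + G z).
Proof.
  intros [F1 F2] [G1 G2]. split.
  - intros b z Dz. apply pd_plus; auto.
  - intros z Cz. destruct (F2 z Cz) as [H1 H2]. destruct (G2 z Cz) as [K1 K2].
    pose proof (within_closure_proper D z Cz) as PF. split.
    + apply (converges_to D _ z _ Cz (lim_plus _ _ _ _ _ H1 K1)).
    + intro b. apply (converges_ext D (fun z => pd b F z + pd b G z)); auto.
      * intros z' Dz'. symmetry. apply pd_plus; auto.
      * apply (converges_to D _ z _ Cz (lim_plus _ _ _ _ _ (H2 b) (K2 b))).
Qed.

Lemma C1_div (D : R * R -> Prop) (F G : R * R -> R) :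
  C1_upto_boundary D F -> C1_upto_boundary D G ->
  (forall z, closure D z -> G z <> 0 /\ trace D G z <> 0) ->
  C1_upto_boundary D (fun z => F z / G z).
Proof.
  intros [F1 F2] [G1 G2] Hn.
  assert (Hn' : forall z, D z -> G z <> 0) by (intros z Dz; apply Hn, subset_closure, Dz).
  split.
  - intros b z Dz. apply pd_div; auto.
  - intros z Cz. destruct (F2 z Cz) as [H1 H2]. destruct (G2 z Cz) as [K1 K2].
    pose proof (within_closure_proper D z Cz) as PF. destruct (Hn z Cz) as [_ N].
    pose proof (lim_inv _ _ _ N K1) as I1.
    split.
    + apply (converges_to D _ z _ Cz (lim_mult _ _ _ _ _ H1 I1)).
    + intro b.
      apply (converges_ext D (fun z => (pd b F z * G z + - (F z * pd b G z)) * (/ G z * / G z))); auto.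
      * intros z' Dz'. destruct (pd_div b F G z') as [_ E]; auto. rewrite E.
        field. auto.
      * apply (converges_to D _ z _ Cz
          (lim_mult _ _ _ _ _
            (lim_plus _ _ _ _ _ (lim_mult _ _ _ _ _ (H2 b) K1)
               (lim_opp _ _ _ (lim_mult _ _ _ _ _ H1 (K2 b))))
            (lim_mult _ _ _ _ _ I1 I1))).
Qed.

Lemma reduced_equation (Om : R * R -> Prop) (alpha beta1 beta2 kappa phi u : R * R -> R) (z : R * R) :
  open Om -> Ck_open 2 Om alpha -> Ck_open 4 Om u -> Om z -> alpha z <> 0 ->
  solves_pde Om alpha beta1 beta2 kappa phi u ->
  dx (dx u) z + dy (dy u) z + coef_a alpha beta1 z * dx u z + coef_b alpha beta2 z * dy u z
  + coef_d alpha kappa z * u z = coef_f alpha phi z.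
Proof.
  intros HO Ha Hu Oz Hz Hpde. specialize (Hpde z Oz).
  assert (E1 : dx (fun z' => alpha z' * dx u z') z = dx alpha z * dx u z + alpha z * dx (dx u) z).
  { apply (pd_mult true alpha (dx u) z).
    - exact (Ck_open_pdable _ _ _ true _ Ha Oz).
    - exact (Ck_open_pdable _ _ _ true _ (Ck_open_pd _ _ _ true Hu) Oz). }
  assert (E2 : dy (fun z' => alpha z' * dy u z') z = dy alpha z * dy u z + alpha z * dy (dy u) z).
  { apply (pd_mult false alpha (dy u) z).
    - exact (Ck_open_pdable _ _ _ false _ Ha Oz).
    - exact (Ck_open_pdable _ _ _ false _ (Ck_open_pd _ _ _ false Hu) Oz). }
  rewrite E1, E2 in Hpde. unfold coef_a, coef_b, coef_d, coef_f. rewrite <- Hpde.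
  field. auto.
Qed.

Lemma reduced_equation_derivative (Om : R * R -> Prop) (a b d f u : R * R -> R) (dir : bool) (z : R * R) :
  open Om -> C1_upto_boundary Om a -> C1_upto_boundary Om b -> C1_upto_boundary Om d ->
  Ck_open 4 Om u ->
  (forall z, Om z -> dx (dx u) z + dy (dy u) z + a z * dx u z + b z * dy u z + d z * u z = f z) ->
  Om z ->
  pd dir (dx (dx u)) z + pd dir (dy (dy u)) z + (pd dir a z * dx u z + a z * pd dir (dx u) z)
  + (pd dir b z * dy u z + b z * pd dir (dy u) z) + (pd dir d z * u z + d z * pd dir u z)
  = pd dir f z.
Proof.
  intros HO [Ha _] [Hb _] [Hd _] Hu HE Oz.
  rewrite <- (pd_ext Om dir _ f z HO HE Oz).
  pose proof (Ck_open_pd _ _ _ true Hu : Ck_open 3 Om (dx u)) as Hx.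
  pose proof (Ck_open_pd _ _ _ false Hu : Ck_open 3 Om (dy u)) as Hy.
  pose proof (Ck_open_pd _ _ _ true Hx : Ck_open 2 Om (dx (dx u))) as Hxx.
  pose proof (Ck_open_pd _ _ _ false Hy : Ck_open 2 Om (dy (dy u))) as Hyy.
  pose proof (Ck_open_pdable _ _ _ dir z Hu Oz) as du.
  pose proof (Ck_open_pdable _ _ _ dir z Hx Oz) as dux.
  pose proof (Ck_open_pdable _ _ _ dir z Hy Oz) as duy.
  pose proof (Ck_open_pdable _ _ _ dir z Hxx Oz) as duxx.
  pose proof (Ck_open_pdable _ _ _ dir z Hyy Oz) as duyy.
  destruct (pd_mult dir a (dx u) z (Ha dir z Oz) dux) as [p1 e1].
  destruct (pd_mult dir b (dy u) z (Hb dir z Oz) duy) as [p2 e2].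
  destruct (pd_mult dir d u z (Hd dir z Oz) du) as [p3 e3].
  destruct (pd_plus dir _ _ z duxx duyy) as [p4 e4].
  destruct (pd_plus dir _ _ z p4 p1) as [p5 e5].
  destruct (pd_plus dir _ _ z p5 p2) as [p6 e6].
  destruct (pd_plus dir _ _ z p6 p3) as [p7 e7].
  rewrite e7, e6, e5, e4, e3, e2, e1. ring.
Qed.

Lemma trace_identity (D : R * R -> Prop) (F G : R * R -> R) (z : R * R) (l : R) :
  closure D z -> (forall w, D w -> F w = G w) ->
  filterlim F (within D (locally z)) (locally l) -> converges D G z -> l = trace D G z.
Proof.
  intros Cz E HF HG. symmetry. apply trace_eq; auto.
  eapply filterlim_ext_loc; [|exact HF]. exists (mkposreal 1 Rlt_0_1). auto.
Qed.

(** Both sides of an identity valid inside the domain have limits at the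
    boundary, hence the identity holds for the limits. *)
Lemma reduced_equation_trace (Om : R * R -> Prop) (a b d f u : R * R -> R) (z : R * R) :
  open Om -> C1_upto_boundary Om a -> C1_upto_boundary Om b -> C1_upto_boundary Om d ->
  C1_upto_boundary Om f -> Ck_open 4 Om u ->
  (forall z, Om z -> dx (dx u) z + dy (dy u) z + a z * dx u z + b z * dy u z + d z * u z = f z) ->
  closure Om z ->
  let tr F := trace Om F z in
  tr (dx (dx u)) + tr (dy (dy u)) + tr a * tr (dx u) + tr b * tr (dy u) + tr d * tr u = tr f /\
  forall dir,
  tr (pd dir (dx (dx u))) + tr (pd dir (dy (dy u))) + (tr (pd dir a) * tr (dx u) + tr a * tr (pd dir (dx u)))
  + (tr (pd dir b) * tr (dy u) + tr b * tr (pd dir (dy u))) + (tr (pd dir d) * tr u + tr d * tr (pd dir u))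
  = tr (pd dir f).
Proof.
  intros HO Ha Hb Hd Hf Hu HE Cz tr.
  pose proof (within_closure_proper Om z Cz) as PF.
  assert (cu : forall k F, Ck_open k Om F -> converges Om F z).
  { intros k F HF. apply ucont_converges; auto. apply (Ck_open_ucont _ _ _ HF). }
  pose proof (Ck_open_pd _ _ _ true Hu : Ck_open 3 Om (dx u)) as Hx.
  pose proof (Ck_open_pd _ _ _ false Hu : Ck_open 3 Om (dy u)) as Hy.
  pose proof (Ck_open_pd _ _ _ true Hx : Ck_open 2 Om (dx (dx u))) as Hxx.
  pose proof (Ck_open_pd _ _ _ false Hy : Ck_open 2 Om (dy (dy u))) as Hyy.
  destruct Ha as [Ha1 Ha2], Hb as [Hb1 Hb2], Hd as [Hd1 Hd2], Hf as [Hf1 Hf2].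
  destruct (Ha2 z Cz) as [la lda], (Hb2 z Cz) as [lb ldb], (Hd2 z Cz) as [ld ldd], (Hf2 z Cz) as [lf ldf].
  pose proof (cu _ _ Hu) as lu. pose proof (cu _ _ Hx) as lux. pose proof (cu _ _ Hy) as luy.
  pose proof (cu _ _ Hxx) as luxx. pose proof (cu _ _ Hyy) as luyy.
  unfold tr; clear tr. split.
  - apply (trace_identity Om _ f z _ Cz HE); auto.
    lims.
  - intro dir.
    pose proof (cu _ _ (Ck_open_pd _ _ _ dir Hu)) as du.
    pose proof (cu _ _ (Ck_open_pd _ _ _ dir Hx)) as dux.
    pose proof (cu _ _ (Ck_open_pd _ _ _ dir Hy)) as duy.
    pose proof (cu _ _ (Ck_open_pd _ _ _ dir Hxx)) as duxx.
    pose proof (cu _ _ (Ck_open_pd _ _ _ dir Hyy)) as duyy.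
    pose proof (lda dir) as la'. pose proof (ldb dir) as lb'. pose proof (ldd dir) as ld'.
    apply (trace_identity Om (fun w => pd dir (dx (dx u)) w + pd dir (dy (dy u)) w
      + (pd dir a w * dx u w + a w * pd dir (dx u) w)
      + (pd dir b w * dy u w + b w * pd dir (dy u) w)
      + (pd dir d w * u w + d w * pd dir u w)) (pd dir f) z _ Cz); auto.
    + intros w Ow. apply (reduced_equation_derivative Om a b d f u dir w); auto; split; auto.
    + lims.
Qed.

(** * The differentiated boundary condition *)

Lemma interior_open {X : UniformSpace} (D : X -> Prop) : open (interior D).
Proof. intros z Hz. apply locally_locally, Hz. Qed.

Lemma interior_subset {X : UniformSpace} (D : X -> Prop) (z : X) : interior D z -> D z.
Proof. intros [e He]. apply He, ball_center. Qed.

Lemma open_interval_interior (T : R -> Prop) (a b x : R) :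
  is_connected T -> T a -> T b -> a < x < b -> interior T x.
Proof.
  intros HT Ta Tb Hx.
  assert (He : 0 < Rmin (x - a) (b - x)) by (apply Rmin_pos; lra).
  exists (mkposreal _ He). intros y By. change (Rabs (y - x) < Rmin (x - a) (b - x)) in By.
  apply Rabs_def2 in By. pose proof (Rmin_l (x - a) (b - x)). pose proof (Rmin_r (x - a) (b - x)).
  apply (HT a b); auto. lra.
Qed.

Lemma interval_closure_interior (T : R -> Prop) (t : R) :
  nontrivial_interval T -> T t -> closure (interior T) t.
Proof.
  intros [HT (a & b & Hab & Ta & Tb)] Tt eps. pose proof (cond_pos eps) as He.
  destruct (Rlt_le_dec t b) as [H|H].
  - assert (Hm : 0 < Rmin eps (b - t)) by (apply Rmin_pos; lra).
    pose proof (Rmin_l eps (b - t)). pose proof (Rmin_r eps (b - t)).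
    exists (t + Rmin eps (b - t) / 2). split.
    + apply (open_interval_interior T t b); auto. lra.
    + change (Rabs (t + Rmin eps (b - t) / 2 - t) < eps). apply Rabs_def1; lra.
  - assert (Hm : 0 < Rmin eps (t - a)) by (apply Rmin_pos; lra).
    pose proof (Rmin_l eps (t - a)). pose proof (Rmin_r eps (t - a)).
    exists (t - Rmin eps (t - a) / 2). split.
    + apply (open_interval_interior T a t); auto. lra.
    + change (Rabs (t - Rmin eps (t - a) / 2 - t) < eps). apply Rabs_def1; lra.
Qed.

Lemma locally_lipschitz (f : R -> R) (s : R) :
  ex_derive f s -> exists C delta, 0 < C /\ 0 < delta /\
    forall s', Rabs (s' - s) < delta -> Rabs (f s' - f s) <= C * Rabs (s' - s).
Proof.
  intros [l Hl]. apply is_derive_Reals in Hl. destruct (Hl 1 Rlt_0_1) as [d Hd].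
  exists (Rabs l + 1), d. pose proof (Rabs_pos l). split; [lra|]. split; [apply cond_pos|].
  intros s' Hs'. destruct (Req_dec s' s) as [->|N].
  - rewrite !Rminus_diag, Rabs_R0. lra.
  - specialize (Hd (s' - s) ltac:(lra) Hs'). replace (s + (s' - s)) with s' in Hd by ring.
    replace (f s' - f s) with (((f s' - f s) / (s' - s) - l + l) * (s' - s)) by (field; lra).
    rewrite Rabs_mult. apply Rmult_le_compat_r; [apply Rabs_pos|].
    eapply Rle_trans; [apply Rabs_triang|]. lra.
Qed.

Lemma derive_zero_of_quadratic (f : R -> R) (s C : R) :
  f s = 0 -> locally s (fun s' => Rabs (f s') <= C * (s' - s) ^ 2) -> is_derive f s 0.
Proof.
  intros Hf [d Hd]. apply is_derive_Reals. intros eps Heps.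
  set (C' := Rabs C + 1). assert (HC : 0 < C') by (unfold C'; pose proof (Rabs_pos C); lra).
  assert (Hm : 0 < Rmin d (eps / C')).
  { apply Rmin_pos; [apply cond_pos | apply Rdiv_lt_0_compat; auto]. }
  exists (mkposreal _ Hm). intros h Hh0 Hh; simpl in Hh.
  rewrite Hf, !Rminus_0_r.
  assert (Hh1 : Rabs h < d) by (eapply Rlt_le_trans; [exact Hh|apply Rmin_l]).
  assert (Hh2 : Rabs h < eps / C') by (eapply Rlt_le_trans; [exact Hh|apply Rmin_r]).
  assert (B : Rabs (f (s + h)) <= C * (s + h - s) ^ 2).
  { apply Hd. change (Rabs (s + h - s) < d). replace (s + h - s) with h by ring. auto. }
  replace (s + h - s) with h in B by ring.
  pose proof (Rabs_pos_lt h Hh0) as Ph.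
  unfold Rdiv. rewrite Rabs_mult, Rabs_inv.
  apply (Rmult_lt_reg_r (Rabs h)); auto. rewrite Rmult_assoc, Rinv_l, Rmult_1_r by lra.
  apply (Rmult_lt_compat_r C') in Hh2; auto. unfold Rdiv in Hh2.
  rewrite Rmult_assoc, Rinv_l, Rmult_1_r in Hh2 by lra.
  assert (h ^ 2 = Rabs h * Rabs h) as E by (rewrite <- Rabs_mult, Rabs_right; [ring|nra]).
  rewrite E in B.
  assert (C <= C') by (unfold C'; pose proof (Rle_abs C); lra).
  nra.
Qed.

Lemma Rminus_plus_cancel (a b : R) : a - b + b = a.
Proof. ring. Qed.

(** Inside the domain this would be the chain rule. Here the curve runs in the
    boundary, where [F] need not be differentiable, but the first order Taylor
    estimate between two boundary points shows that the trace differs from its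
    linear part by a quadratic term. *)
Lemma trace_chain_rule (Om : R * R -> Prop) (F : R * R -> R) (p q : R -> R) (s : R) :
  open Om -> smooth_boundary Om -> Ck_open 2 Om F ->
  locally s (fun s' => frontier Om (p s', q s')) -> ex_derive p s -> ex_derive q s ->
  is_derive (fun s' => trace Om F (p s', q s')) s
    (trace Om (dx F) (p s, q s) * Derive p s + trace Om (dy F) (p s, q s) * Derive q s).
Proof.
  intros HO HS HF Hfr Hp Hq.
  assert (F0 : frontier Om (p s, q s)) by (destruct Hfr as [e He]; apply He, ball_center).
  destruct (taylor_boundary Om 1 F (p s, q s) HO HS HF F0) as (d & K & Hd & HK & HT).
  destruct (locally_lipschitz p s Hp) as (Cp & dp & HCp & Hdp & Lp).
  destruct (locally_lipschitz q s Hq) as (Cq & dq & HCq & Hdq & Lq).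
  set (Fx := trace Om (dx F) (p s, q s)). set (Fy := trace Om (dy F) (p s, q s)).
  set (F00 := trace Om F (p s, q s)).
  set (R1 := fun s' => trace Om F (p s', q s') - (F00 + (Fx * (p s' - p s) + Fy * (q s' - q s)))).
  assert (Hlin : is_derive (fun s' => F00 + (Fx * (p s' - p s) + Fy * (q s' - q s))) s
                   (Fx * Derive p s + Fy * Derive q s)).
  { auto_derive; auto. change (fun x => p x) with p. change (fun x => q x) with q. ring. }
  assert (HR : is_derive R1 s 0).
  { apply (derive_zero_of_quadratic _ _ (K * (Cp + Cq) ^ 2)).
    - unfold R1. rewrite !Rminus_diag. unfold F00. ring.
    - destruct Hfr as [df Hfr].
      set (C := Cp + Cq).
      assert (Hm : 0 < Rmin (Rmin dp dq) (Rmin df (d / C))).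
      { apply Rmin_pos; apply Rmin_pos; auto; [apply cond_pos|apply Rdiv_lt_0_compat; unfold C; lra]. }
      exists (mkposreal _ Hm). intros s' Hs'.
      change (Rabs (s' - s) < Rmin (Rmin dp dq) (Rmin df (d / C))) in Hs'.
      pose proof (Rmin_l (Rmin dp dq) (Rmin df (d / C))). pose proof (Rmin_r (Rmin dp dq) (Rmin df (d / C))).
      pose proof (Rmin_l dp dq). pose proof (Rmin_r dp dq).
      pose proof (Rmin_l df (d / C)). pose proof (Rmin_r df (d / C)).
      destruct (Req_dec s' s) as [->|N].
      { unfold R1. rewrite !Rminus_diag.
        match goal with |- Rabs ?x <= _ => replace x with 0 by (unfold F00; ring) end.
        rewrite Rabs_R0. simpl. lra. }
      set (r := Rabs (s' - s)) in *. assert (Hr : 0 < r) by (apply Rabs_pos_lt; lra).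
      specialize (Lp s' ltac:(fold r; lra)). specialize (Lq s' ltac:(fold r; lra)). fold r in Lp, Lq.
      assert (HCr : C * r < d).
      { assert (Hrd : r < d / C) by lra. apply (Rmult_lt_compat_r C) in Hrd; [|unfold C; lra].
        unfold Rdiv in Hrd. rewrite Rmult_assoc, Rinv_l, Rmult_1_r in Hrd by (unfold C; lra). lra. }
      assert (Hp1 : Rabs (p s' - p s) <= C * r) by (unfold C; nra).
      assert (Hq1 : Rabs (q s' - q s) <= C * r) by (unfold C; nra).
      assert (Hfs : frontier Om (p s', q s')).
      { apply Hfr. change (Rabs (s' - s) < df). fold r. lra. }
      assert (HCr0 : 0 < C * r) by (unfold C; nra).
      specialize (HT (p s, q s) (p s', q s') (C * r) (proj1 F0) (proj1 Hfs) (ball_center _ (mkposreal d Hd))).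
      replace ((s' - s) ^ 2) with (r ^ 2) by (unfold r; apply pow2_abs).
      replace (K * C ^ 2 * r ^ 2) with (K * (C * r) ^ 2) by ring.
      unfold R1. 
      replace (F00 + (Fx * (p s' - p s) + Fy * (q s' - q s)))
        with (taylor (trace_at Om (p s, q s)) 1 F (p s' - p s) (q s' - q s)).
      2: { rewrite taylor_S. unfold taylor. rewrite sum_O. unfold hom, trace_at. fold Fx Fy F00. simpl INR. field. }
      apply HT; auto; try lra.
      apply (proj2 (ball_pair _ _ _)). simpl. lra. }
  apply (is_derive_ext (fun s' => R1 s' + (F00 + (Fx * (p s' - p s) + Fy * (q s' - q s))))).
  { intro s'. exact (Rminus_plus_cancel _ _). }
  pose proof (is_derive_plus (V := R_NormedModule) _ _ _ _ _ HR Hlin) as P.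
  is_derive_by P.
  exact (Rplus_0_l _).
Qed.

Lemma iterated_chain_rule (J : R -> Prop)
    (g U Ux Uy Uxx Uxy Uyy Uxxx Uxxy Uxyy Uyyy P1 P2 P3 Q1 Q2 Q3 : R -> R) :
  open J ->
  (forall s, J s -> g s = U s) ->
  (forall s, J s -> is_derive U s (Ux s * P1 s + Uy s * Q1 s)) ->
  (forall s, J s -> is_derive Ux s (Uxx s * P1 s + Uxy s * Q1 s)) ->
  (forall s, J s -> is_derive Uy s (Uxy s * P1 s + Uyy s * Q1 s)) ->
  (forall s, J s -> is_derive Uxx s (Uxxx s * P1 s + Uxxy s * Q1 s)) ->
  (forall s, J s -> is_derive Uxy s (Uxxy s * P1 s + Uxyy s * Q1 s)) ->
  (forall s, J s -> is_derive Uyy s (Uxyy s * P1 s + Uyyy s * Q1 s)) ->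
  (forall s, J s -> is_derive P1 s (P2 s)) -> (forall s, J s -> is_derive Q1 s (Q2 s)) ->
  (forall s, J s -> is_derive P2 s (P3 s)) -> (forall s, J s -> is_derive Q2 s (Q3 s)) ->
  forall s, J s ->
    Derive_n g 1 s = P1 s * Ux s + Q1 s * Uy s /\
    Derive_n g 2 s = P1 s * P1 s * Uxx s + 2 * P1 s * Q1 s * Uxy s + Q1 s * Q1 s * Uyy s
                     + P2 s * Ux s + Q2 s * Uy s /\
    Derive_n g 3 s = P1 s * P1 s * P1 s * Uxxx s + 3 * P1 s * P1 s * Q1 s * Uxxy s
                     + 3 * P1 s * Q1 s * Q1 s * Uxyy s + Q1 s * Q1 s * Q1 s * Uyyy s
                     + 3 * P1 s * P2 s * Uxx s + 3 * (P1 s * Q2 s + P2 s * Q1 s) * Uxy s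
                     + 3 * Q1 s * Q2 s * Uyy s + P3 s * Ux s + Q3 s * Uy s.
Proof.
  intros HJ E0 dU dUx dUy dUxx dUxy dUyy dP1 dQ1 dP2 dQ2.
  assert (nbhd : forall (f k : R -> R) s, (forall r, J r -> f r = k r) -> J s -> Derive f s = Derive k s).
  { intros f k s E Js. apply Derive_ext_loc. generalize (HJ s Js). apply filter_imp. auto. }
  assert (E1 : forall s, J s -> Derive_n g 1 s = P1 s * Ux s + Q1 s * Uy s).
  { intros s Js. simpl. change (fun x => g x) with g. rewrite (nbhd g U s E0 Js).
    rewrite (is_derive_unique _ _ _ (dU s Js)). ring. }
  assert (E2 : forall s, J s -> Derive_n g 2 s
    = P1 s * P1 s * Uxx s + 2 * P1 s * Q1 s * Uxy s + Q1 s * Q1 s * Uyy s + P2 s * Ux s + Q2 s * Uy s).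
  { intros s Js. change (Derive_n g 2 s) with (Derive (Derive_n g 1) s).
    rewrite (nbhd _ _ s E1 Js). apply is_derive_unique.
    auto_derive.
    - repeat split; eexists; eauto.
    - change (fun x => P1 x) with P1. change (fun x => Q1 x) with Q1.
      change (fun x => Ux x) with Ux. change (fun x => Uy x) with Uy.
      rewrite (is_derive_unique _ _ _ (dP1 s Js)), (is_derive_unique _ _ _ (dQ1 s Js)),
        (is_derive_unique _ _ _ (dUx s Js)), (is_derive_unique _ _ _ (dUy s Js)). ring. }
  intros s Js. split; [auto|]. split; [auto|].
  change (Derive_n g 3 s) with (Derive (Derive_n g 2) s).
  rewrite (nbhd _ _ s E2 Js). apply is_derive_unique.
  auto_derive.
  - repeat split; eexists; eauto.
  - change (fun x => P1 x) with P1. change (fun x => Q1 x) with Q1.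
    change (fun x => P2 x) with P2. change (fun x => Q2 x) with Q2.
    change (fun x => Ux x) with Ux. change (fun x => Uy x) with Uy.
    change (fun x => Uxx x) with Uxx. change (fun x => Uxy x) with Uxy. change (fun x => Uyy x) with Uyy.
    rewrite (is_derive_unique _ _ _ (dP1 s Js)), (is_derive_unique _ _ _ (dQ1 s Js)),
      (is_derive_unique _ _ _ (dP2 s Js)), (is_derive_unique _ _ _ (dQ2 s Js)),
      (is_derive_unique _ _ _ (dUx s Js)), (is_derive_unique _ _ _ (dUy s Js)),
      (is_derive_unique _ _ _ (dUxx s Js)), (is_derive_unique _ _ _ (dUxy s Js)),
      (is_derive_unique _ _ _ (dUyy s Js)). ring.
Qed.

(** * Linear relations between the derivatives at a boundary point *)

(** What the equation, its two first derivatives and the boundary condition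
    differentiated up to three times along the curve say about the derivatives
    of the solution at one boundary point. *)
Definition boundary_system {B : bdata} (Ux Uy Uxx Uxy Uyy Uxxx Uxxy Uxyy Uyyy : R) : Prop :=
  Uxx + Uyy + a00 * Ux + b00 * Uy + d00 * g0 = f00 /\
  Uxxx + Uxyy + (a10 * Ux + a00 * Uxx) + (b10 * Uy + b00 * Uxy) + (d10 * g0 + d00 * Ux) = f10 /\
  Uxxy + Uyyy + (a01 * Ux + a00 * Uxy) + (b01 * Uy + b00 * Uyy) + (d01 * g0 + d00 * Uy) = f01 /\
  g1 = p1 * Ux + q1 * Uy /\
  g2 = p1 * p1 * Uxx + 2 * p1 * q1 * Uxy + q1 * q1 * Uyy + p2 * Ux + q2 * Uy /\
  g3 = p1 * p1 * p1 * Uxxx + 3 * p1 * p1 * q1 * Uxxy + 3 * p1 * q1 * q1 * Uxyy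
       + q1 * q1 * q1 * Uyyy + 3 * p1 * p2 * Uxx + 3 * (p1 * q2 + p2 * q1) * Uxy
       + 3 * q1 * q2 * Uyy + p3 * Ux + q3 * Uy.

(** The parts of the Taylor coefficients [u_yy / 2], [u_xx / 2], [u_yyy / 6],
    [u_xxy / 2] and [u_xxx / 6] that depend on the data alone; the rest is a
    combination of [u_x], [u_xy] and [u_xyy]. *)
Definition known_yy {B : bdata} : R := eta1 * f00 + g0 * om1 + g1 * om7 + g2 * om12.
Definition known_xx {B : bdata} : R := eta3 * f00 + g0 * om3 + g1 * om9 + g2 * om14.
Definition known_yyy {B : bdata} : R :=
  eta2 * f00 + eta6 * f01 + eta8 * f10 + g0 * om2 + g1 * om8 + g2 * om13 + g3 * om17.
Definition known_xxy {B : bdata} : R :=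
  eta4 * f00 + eta7 * f01 + eta9 * f10 + g0 * om4 + g1 * om10 + g2 * om15 + g3 * om18.
Definition known_xxx {B : bdata} : R :=
  eta5 * f00 + om5 * g0 + om11 * g1 + om16 * g2 + f10 / 6.

Lemma D4_factor {B : bdata} : D4 = D2 * D3.
Proof. unfold D4, D2, D3; ring. Qed.

(** The six relations are linear in the nine derivatives. Order by order they
    are solved for all but [u_x], [u_xy], [u_xyy]: the pivots are [q1], then
    [D2] from the pair (Laplacian, second tangential derivative), then
    [D4 = D2 * D3] from the two differentiated equations and the third
    tangential derivative. *)
Lemma derivatives_from_boundary_system {B : bdata} (Ux Uy Uxx Uxy Uyy Uxxx Uxxy Uxyy Uyyy : R) :
  q1 <> 0 -> D2 <> 0 -> D3 <> 0 ->
  boundary_system Ux Uy Uxx Uxy Uyy Uxxx Uxxy Uxyy Uyyy ->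
  Uy = xi1 * Ux + om6 * g1 /\
  Uyy = 2 * (xi2 * Ux + xi7 * Uxy + known_yy) /\
  Uxx = 2 * (xi4 * Ux + xi9 * Uxy + known_xx) /\
  Uyyy = 6 * (xi3 * Ux + xi8 * Uxy + xi12 * Uxyy + known_yyy) /\
  Uxxy = 2 * (xi5 * Ux + xi10 * Uxy + xi13 * Uxyy + known_xxy) /\
  Uxxx = 6 * (xi6 * Ux + xi11 * Uxy - Uxyy / 6 + known_xxx).
Proof.
  intros Hq H2 H3 (E0 & Ex & Ey & F1 & F2 & F3).
  unfold known_yy, known_xx, known_yyy, known_xxy, known_xxx.
  assert (H4 : D4 <> 0) by (rewrite D4_factor; apply Rmult_integral_contrapositive; auto).
  assert (ey : Uy = xi1 * Ux + om6 * g1).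
  { rewrite F1. unfold xi1, om6, s1, z1. field; auto. }
  assert (exx : Uxx = f00 - (Uyy + a00 * Ux + b00 * Uy + d00 * g0)) by lra.
  assert (exxx : Uxxx = f10 - (Uxyy + a10 * Ux + a00 * Uxx + b10 * Uy + b00 * Uxy
                               + d10 * g0 + d00 * Ux)) by lra.
  assert (exxy : Uxxy = f01 - (Uyyy + a01 * Ux + a00 * Uxy + b01 * Uy + b00 * Uyy
                               + d01 * g0 + d00 * Uy)) by lra.
  assert (eyy : Uyy = 2 * (xi2 * Ux + xi7 * Uxy
                           + (eta1 * f00 + g0 * om1 + g1 * om7 + g2 * om12))).
  { rewrite F1, F2, <- E0.
    unfold xi2, xi7, eta1, om1, om7, om12, s2, s3, z3, z2, z4, z5, D2 in *.
    field; auto. }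
  split; [exact ey|]. split; [exact eyy|].
  assert (eyyy : Uyyy = 6 * (xi3 * Ux + xi8 * Uxy + xi12 * Uxyy
    + (eta2 * f00 + eta6 * f01 + eta8 * f10 + g0 * om2 + g1 * om8 + g2 * om13 + g3 * om17))).
  { rewrite F1, F2, F3, <- E0, <- Ex, <- Ey.
    unfold xi3, xi8, xi12, eta2, eta6, eta8, om2, om8, om13, om17,
      s4, s5, s6, z7, z8, z10, z6, z9, z11, z12.
    rewrite D4_factor in *. unfold D2, D3 in *. field; auto. }
  repeat split; auto.
  - rewrite F1, F2, <- E0.
    unfold xi4, xi9, eta3, om3, om9, om14, s1, z1, s2, s3, z3, z2, z4, z5, D2 in *.
    field; auto.
  - rewrite exxy, eyyy, eyy, ey.
    unfold xi1, xi2, xi3, xi7, xi8, xi12, xi5, xi10, xi13, om1, om7, om12, om6, eta1, eta2,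
      eta4, eta6, eta7, eta8, eta9, om2, om8, om13, om17, om4, om10, om15, om18.
    field.
  - rewrite exxx, exx, eyy, ey.
    unfold xi1, xi2, xi6, xi7, xi11, om1, om7, om12, om6, eta1, eta5, om5, om11, om16.
    field.
Qed.

Lemma third_order_mixed (Om : R * R -> Prop) (u : R * R -> R) (z : R * R) :
  open Om -> Ck_open 4 Om u -> Om z ->
  dx (dy (dx u)) z = dy (dx (dx u)) z /\ dx (dx (dy u)) z = dy (dx (dx u)) z /\
  dy (dx (dy u)) z = dy (dy (dx u)) z /\ dx (dy (dy u)) z = dy (dy (dx u)) z.
Proof.
  intros HO Hu Oz.
  assert (M : forall w, Om w -> dx (dy u) w = dy (dx u) w).
  { intros w Ow. apply (mixed_partials Om); auto. apply (Ck_open_le 2 4); auto. }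
  assert (Mx : dx (dy (dx u)) z = dy (dx (dx u)) z).
  { apply (mixed_partials Om); auto. apply (Ck_open_le 2 3); auto. exact (Ck_open_pd _ _ _ true Hu). }
  assert (My : dx (dy (dy u)) z = dy (dx (dy u)) z).
  { apply (mixed_partials Om); auto. apply (Ck_open_le 2 3); auto. exact (Ck_open_pd _ _ _ false Hu). }
  assert (Ex : dx (dx (dy u)) z = dx (dy (dx u)) z) by exact (pd_ext Om true _ _ z HO M Oz).
  assert (Ey : dy (dx (dy u)) z = dy (dy (dx u)) z) by exact (pd_ext Om false _ _ z HO M Oz).
  repeat split; congruence.
Qed.

Lemma trace_mixed (Om : R * R -> Prop) (u : R * R -> R) (z : R * R) :
  open Om -> Ck_open 4 Om u -> closure Om z ->
  let tr F := trace Om F z in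
  tr (dx (dy u)) = tr (dy (dx u)) /\
  tr (dx (dy (dx u))) = tr (dy (dx (dx u))) /\ tr (dx (dx (dy u))) = tr (dy (dx (dx u))) /\
  tr (dy (dx (dy u))) = tr (dy (dy (dx u))) /\ tr (dx (dy (dy u))) = tr (dy (dy (dx u))).
Proof.
  intros HO Hu Cz tr.
  assert (cv : forall b c F, Ck_open 2 Om F -> converges Om (pd b (pd c F)) z).
  { intros b c F HF. apply ucont_converges; auto.
    apply (Ck_open_ucont 0), Ck_open_pd, Ck_open_pd, HF. }
  pose proof (Ck_open_le 2 3 _ _ ltac:(lia) (Ck_open_pd _ _ _ true Hu)) as Hx.
  repeat split; unfold tr.
  - apply trace_ext; auto.
    + intros w Ow. symmetry. apply (mixed_partials Om); auto. apply (Ck_open_le 2 4); auto.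
    + apply (cv false true). apply (Ck_open_le 2 4); auto.
  - apply trace_ext; [auto | | exact (cv false true _ Hx)].
    intros w Ow. destruct (third_order_mixed Om u w HO Hu Ow) as (M1 & M2 & M3 & M4). symmetry. exact M1.
  - apply trace_ext; [auto | | exact (cv false true _ Hx)].
    intros w Ow. destruct (third_order_mixed Om u w HO Hu Ow) as (M1 & M2 & M3 & M4). symmetry. exact M2.
  - apply trace_ext; [auto | | exact (cv false false _ Hx)].
    intros w Ow. destruct (third_order_mixed Om u w HO Hu Ow) as (M1 & M2 & M3 & M4). symmetry. exact M3.
  - apply trace_ext; [auto | | exact (cv false false _ Hx)].
    intros w Ow. destruct (third_order_mixed Om u w HO Hu Ow) as (M1 & M2 & M3 & M4). symmetry. exact M4.
Qed.

Lemma curve_limit (Om : R * R -> Prop) (T : R -> Prop) (p q : R -> R) (t : R) :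
  parametrizes_boundary Om T p q -> ucont_on T p -> ucont_on T q -> T t ->
  filterlim (fun s => (p s, q s)) (within (interior T) (locally t))
    (within (closure Om) (locally (p t, q t))).
Proof.
  intros [Hp _] Up Uq Tt P [e He].
  destruct (Up e) as [d1 H1]. destruct (Uq e) as [d2 H2].
  exists (mkposreal (Rmin d1 d2) (Rmin_pos _ _ (cond_pos d1) (cond_pos d2))).
  intros s Bs Is. pose proof (interior_subset T s Is) as Ts. apply He; [|apply Hp, Ts].
  split; simpl.
  - apply H1; auto. eapply ball_le; [|exact Bs]. apply Rmin_l.
  - apply H2; auto. eapply ball_le; [|exact Bs]. apply Rmin_r.
Qed.

(** At interior parameters the identities follow from the chain rule; at an end
    point of the interval they are limits of those, because the traces are
    continuous along the curve. *)
Lemma boundary_condition_derivatives (Om : R * R -> Prop) (T : R -> Prop) (u : R * R -> R)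
    (p q g : R -> R) (t : R) :
  open Om -> smooth_boundary Om -> nontrivial_interval T -> parametrizes_boundary Om T p q ->
  Ck_interval 3 T p -> Ck_interval 3 T q -> Ck_interval 3 T g -> Ck_closure 4 Om u ->
  (forall t, T t -> u (p t, q t) = g t) -> T t ->
  let tr F := trace Om F (p t, q t) in
  let cu F m := trace (interior T) (Derive_n F m) t in
  cu g 1%nat = cu p 1%nat * tr (dx u) + cu q 1%nat * tr (dy u) /\
  cu g 2%nat = cu p 1%nat * cu p 1%nat * tr (dx (dx u)) + 2 * cu p 1%nat * cu q 1%nat * tr (dy (dx u))
     + cu q 1%nat * cu q 1%nat * tr (dy (dy u)) + cu p 2%nat * tr (dx u) + cu q 2%nat * tr (dy u) /\
  cu g 3%nat = cu p 1%nat * cu p 1%nat * cu p 1%nat * tr (dx (dx (dx u)))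
     + 3 * cu p 1%nat * cu p 1%nat * cu q 1%nat * tr (dy (dx (dx u)))
     + 3 * cu p 1%nat * cu q 1%nat * cu q 1%nat * tr (dy (dy (dx u)))
     + cu q 1%nat * cu q 1%nat * cu q 1%nat * tr (dy (dy (dy u)))
     + 3 * cu p 1%nat * cu p 2%nat * tr (dx (dx u))
     + 3 * (cu p 1%nat * cu q 2%nat + cu p 2%nat * cu q 1%nat) * tr (dy (dx u))
     + 3 * cu q 1%nat * cu q 2%nat * tr (dy (dy u))
     + cu p 3%nat * tr (dx u) + cu q 3%nat * tr (dy u).
Proof.
  intros HO HS HT Hpar [Up Hp] [Uq Hq] [Ug Hg] [Uu Hu] Hbc Tt tr cu.
  set (J := interior T).
  set (V := fun F s => trace Om F (p s, q s)).
  assert (Fr : forall s, T s -> frontier Om (p s, q s)) by apply Hpar.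
  assert (chain : forall F s, Ck_open 2 Om F -> J s ->
    is_derive (V F) s (V (dx F) s * Derive_n p 1 s + V (dy F) s * Derive_n q 1 s)).
  { intros F s HF Js. apply (trace_chain_rule Om F p q s); auto.
    - generalize (Js : locally s T). apply filter_imp. auto.
    - exact (proj2 (Hp 1%nat ltac:(lia)) s Js).
    - exact (proj2 (Hq 1%nat ltac:(lia)) s Js). }
  pose proof (Ck_open_pd _ _ _ true Hu : Ck_open 3 Om (dx u)) as Hux.
  pose proof (Ck_open_pd _ _ _ false Hu : Ck_open 3 Om (dy u)) as Huy.
  pose proof (Ck_open_pd _ _ _ true Hux : Ck_open 2 Om (dx (dx u))) as Huxx.
  pose proof (Ck_open_pd _ _ _ false Hux : Ck_open 2 Om (dy (dx u))) as Huxy.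
  pose proof (Ck_open_pd _ _ _ false Huy : Ck_open 2 Om (dy (dy u))) as Huyy.
  assert (mixed : forall s, J s -> _) by
    (intros s Js; exact (trace_mixed Om u (p s, q s) HO Hu (proj1 (Fr s (interior_subset T s Js))))).
  cbv zeta in mixed.
  assert (onJ : forall s, J s -> _) by
    (refine (iterated_chain_rule J g (V u) (V (dx u)) (V (dy u)) (V (dx (dx u))) (V (dy (dx u)))
       (V (dy (dy u))) (V (dx (dx (dx u)))) (V (dy (dx (dx u)))) (V (dy (dy (dx u))))
       (V (dy (dy (dy u)))) (Derive_n p 1) (Derive_n p 2) (Derive_n p 3)
       (Derive_n q 1) (Derive_n q 2) (Derive_n q 3) _ _ _ _ _ _ _ _ _ _ _ _);
     [ apply interior_open
     | intros s Js; pose proof (interior_subset T s Js) as Ts; rewrite <- (Hbc s Ts); symmetry;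
       apply trace_on_closure; auto; apply (Fr s Ts)
     | intros s Js; apply chain; auto; apply (Ck_open_le 2 4); auto
     | intros s Js; apply chain; auto; apply (Ck_open_le 2 3); auto
     | intros s Js; destruct (mixed s Js) as (M & _); unfold V; rewrite <- M; apply chain; auto;
       apply (Ck_open_le 2 3); auto
     | intros s Js; apply chain; auto
     | intros s Js; destruct (mixed s Js) as (_ & M & _); unfold V; rewrite <- M; apply chain; auto
     | intros s Js; destruct (mixed s Js) as (_ & _ & _ & _ & M); unfold V; rewrite <- M; apply chain; auto
     | intros s Js; apply Derive_correct; exact (proj2 (Hp 2%nat ltac:(lia)) s Js)
     | intros s Js; apply Derive_correct; exact (proj2 (Hq 2%nat ltac:(lia)) s Js)
     | intros s Js; apply Derive_correct; exact (proj2 (Hp 3%nat ltac:(lia)) s Js)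
     | intros s Js; apply Derive_correct; exact (proj2 (Hq 3%nat ltac:(lia)) s Js) ]).
  cbv beta in onJ.
  pose proof (interval_closure_interior T t HT Tt) as Ct.
  pose proof (within_closure_proper J t Ct) as PF.
  pose proof (curve_limit Om T p q t Hpar Up Uq Tt) as Lc.
  pose proof (proj1 (Fr t Tt)) as Cz.
  assert (LV : forall k F, Ck_open k Om F -> filterlim (V F) (within J (locally t)) (locally (tr F))).
  { intros k F HF. apply (filterlim_comp _ _ _ (fun s => (p s, q s)) (trace Om F) _ _ _ Lc).
    apply trace_continuous; auto. apply (Ck_open_ucont _ _ _ HF). }
  pose proof (LV _ _ Hux) as lx. pose proof (LV _ _ Huy) as ly.
  pose proof (LV _ _ Huxx) as lxx. pose proof (LV _ _ Huxy) as lxy. pose proof (LV _ _ Huyy) as lyy.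
  pose proof (LV _ _ (Ck_open_pd _ _ _ true Huxx)) as lxxx.
  pose proof (LV _ _ (Ck_open_pd _ _ _ false Huxx)) as lxxy.
  pose proof (LV _ _ (Ck_open_pd _ _ _ false Huxy)) as lxyy.
  pose proof (LV _ _ (Ck_open_pd _ _ _ false Huyy)) as lyyy.
  assert (Lp : forall m, (m <= 3)%nat -> filterlim (Derive_n p m) (within J (locally t)) (locally (cu p m))).
  { intros m Hm. apply ucont_converges; auto. apply Hp; auto. }
  assert (Lq : forall m, (m <= 3)%nat -> filterlim (Derive_n q m) (within J (locally t)) (locally (cu q m))).
  { intros m Hm. apply ucont_converges; auto. apply Hq; auto. }
  assert (Lg : forall m, (m <= 3)%nat -> converges J (Derive_n g m) t).
  { intros m Hm. apply ucont_converges; auto. apply Hg; auto. }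
  pose proof (Lp 1%nat ltac:(lia)) as p1l. pose proof (Lp 2%nat ltac:(lia)) as p2l. pose proof (Lp 3%nat ltac:(lia)) as p3l.
  pose proof (Lq 1%nat ltac:(lia)) as q1l. pose proof (Lq 2%nat ltac:(lia)) as q2l. pose proof (Lq 3%nat ltac:(lia)) as q3l.
  assert (const : forall c : R, filterlim (fun _ : R => c) (within J (locally t)) (locally c)).
  { intro c. apply (filterlim_const (U := R_UniformSpace)). }
  pose proof (const 2) as c2. pose proof (const 3) as c3.
  assert (fin : forall m (f : R -> R) l, (m <= 3)%nat -> (forall s, J s -> Derive_n g m s = f s) ->
    filterlim f (within J (locally t)) (locally l) -> cu g m = l).
  { intros m f l Hm E Hf. apply trace_eq; auto. eapply filterlim_ext_loc; [|exact Hf].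
    exists (mkposreal 1 Rlt_0_1). intros s _ Js. symmetry. auto. }
  repeat split.
  - eapply fin; [lia | intros s Js; apply (onJ s Js) | lims].
  - eapply fin; [lia | intros s Js; apply (onJ s Js) | lims].
  - eapply fin; [lia | intros s Js; apply (onJ s Js) | lims].
Qed.

(** The value [u] at the point is replaced by [g0] in the three relations coming
    from the equation, and mixed derivatives are brought to one order. *)
Lemma boundary_relations (Om : R * R -> Prop) (T : R -> Prop)
  (alpha beta1 beta2 kappa phi u : R * R -> R) (p q g : R -> R) (t : R) :
  open Om -> smooth_boundary Om -> nontrivial_interval T -> parametrizes_boundary Om T p q ->
  Ck_interval 3 T p -> Ck_interval 3 T q -> Ck_interval 3 T g ->
  Ck_closure 2 Om alpha -> Ck_closure 2 Om beta1 -> Ck_closure 2 Om beta2 ->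
  Ck_closure 2 Om kappa -> Ck_closure 2 Om phi -> Ck_closure 4 Om u ->
  (forall z, closure Om z -> 0 < alpha z) ->
  solves_pde Om alpha beta1 beta2 kappa phi u ->
  (forall t, T t -> u (p t, q t) = g t) -> T t ->
  let tr F := trace Om F (p t, q t) in
  @boundary_system (boundary_data Om T alpha beta1 beta2 kappa phi p q g t)
    (tr (dx u)) (tr (dy u)) (tr (dx (dx u))) (tr (dy (dx u))) (tr (dy (dy u)))
    (tr (dx (dx (dx u)))) (tr (dy (dx (dx u)))) (tr (dy (dy (dx u)))) (tr (dy (dy (dy u)))).
Proof.
  intros HO HS HT Hpar Hp Hq Hg [Ua Ha] [_ Hb1] [_ Hb2] [_ Hk] [_ Hphi] Hu Hpos Hpde Hbc Tt tr.
  pose proof (proj1 (proj1 Hpar t Tt)) as Cz. 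
  assert (nz : forall z, closure Om z -> alpha z <> 0 /\ trace Om alpha z <> 0).
  { intros z Hz. rewrite trace_on_closure; auto. pose proof (Hpos z Hz). split; lra. }
  pose proof (Ck_open_C1 _ _ _ Ha) as Ca.
  assert (Ra : C1_upto_boundary Om (coef_a alpha beta1)).
  { apply C1_div; auto. apply C1_plus; [|apply C1_opp].
    - apply (Ck_open_C1 0). exact (Ck_open_pd _ _ _ true Ha).
    - apply (Ck_open_C1 1), Hb1. }
  assert (Rb : C1_upto_boundary Om (coef_b alpha beta2)).
  { apply C1_div; auto. apply C1_plus; [|apply C1_opp].
    - apply (Ck_open_C1 0). exact (Ck_open_pd _ _ _ false Ha).
    - apply (Ck_open_C1 1), Hb2. }
  assert (Rd : C1_upto_boundary Om (coef_d alpha kappa)).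
  { apply C1_opp, C1_div; auto. apply (Ck_open_C1 1), Hk. }
  assert (Rf : C1_upto_boundary Om (coef_f alpha phi)).
  { apply C1_opp, C1_div; auto. apply (Ck_open_C1 1), Hphi. }
  destruct Hu as [Uu Hu].
  destruct (reduced_equation_trace Om _ _ _ _ u (p t, q t) HO Ra Rb Rd Rf Hu) as [E0 E1]; auto.
  { intros z Oz. apply (reduced_equation Om); auto. apply nz, subset_closure, Oz. }
  destruct (trace_mixed Om u (p t, q t) HO Hu Cz) as (Mxy & _ & _ & _ & Mxyy).
  pose proof (boundary_condition_derivatives Om T u p q g t HO HS HT Hpar Hp Hq Hg (conj Uu Hu) Hbc Tt)
    as (G1 & G2 & G3).
  assert (E : trace Om u (p t, q t) = g t) by (rewrite trace_on_closure; auto).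
  pose proof (E1 true) as Ex. pose proof (E1 false) as Ey.
  change (pd true) with dx in Ex. change (pd false) with dy in Ey.
  rewrite E in E0, Ex, Ey. rewrite Mxy, Mxyy in Ex.
  exact (conj E0 (conj Ex (conj Ey (conj G1 (conj G2 G3))))).
Qed.

(** * Uniform estimates and the distance to the boundary *)

Lemma hom_bounded_upto (Om : R * R -> Prop) (k : nat) (F : R * R -> R) (z0 : R * R) (C : R) :
  Ck_open k Om F -> closure Om z0 -> 0 <= C ->
  exists delta K, 0 < delta /\ 0 <= K /\
    forall (j : nat) (z1 : R * R) (x y : R), (j <= k)%nat -> closure Om z1 -> ball z0 delta z1 ->
      Rabs x <= C -> Rabs y <= C -> Rabs (hom (trace_at Om z1) j F x y) <= K.
Proof.
  intros HF Hz HC. induction k as [|k IH].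
  - destruct (hom_bounded_near Om 0 F z0 C HF Hz HC) as (d & K & Hd & HK & H).
    exists d, K. repeat split; auto. intros j z1 x y Hj. replace j with 0%nat by lia. apply H.
  - destruct (IH (Ck_open_pred _ _ _ HF)) as (d1 & K1 & Hd1 & HK1 & H1).
    destruct (hom_bounded_near Om (S k) F z0 C HF Hz HC) as (d2 & K2 & Hd2 & HK2 & H2).
    exists (Rmin d1 d2), (Rmax K1 K2). split; [apply Rmin_pos; auto|]. split.
    { apply Rle_trans with K1; auto. apply Rmax_l. }
    intros j z1 x y Hj Cz Bz Hx Hy. destruct (le_lt_eq_dec _ _ Hj) as [Hlt | ->].
    + apply Rle_trans with K1; [|apply Rmax_l]. apply H1; auto; [lia|].
      eapply ball_le; [|exact Bz]. apply Rmin_l.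
    + apply Rle_trans with K2; [|apply Rmax_r]. apply H2; auto.
      eapply ball_le; [|exact Bz]. apply Rmin_r.
Qed.

(** Near each boundary point there are a radius and two bounds; the inverse of one
    small number dominates both bounds, so that uniformity over the compact
    part of the boundary is about that number only. *)
Lemma uniform_taylor (Om : R * R -> Prop) (k : nat) (F : R * R -> R) (rho C : R) :
  open Om -> smooth_boundary Om -> Ck_open (S k) Om F -> 0 <= C ->
  exists delta K, 0 < delta /\ 0 <= K /\
    forall z0 : R * R, frontier Om z0 -> Rabs (fst z0) <= rho -> Rabs (snd z0) <= rho ->
      (forall (z : R * R) (r : R), closure Om z -> 0 < r <= delta ->
         Rabs (fst z - fst z0) <= r -> Rabs (snd z - snd z0) <= r ->
         Rabs (trace Om F z - taylor (trace_at Om z0) k F (fst z - fst z0) (snd z - snd z0))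
         <= K * r ^ (S k)) /\
      (forall (j : nat) (x y : R), (j <= k)%nat -> Rabs x <= C -> Rabs y <= C ->
         Rabs (hom (trace_at Om z0) j F x y) <= K).
Proof.
  intros HO HS HF HC.
  set (Q := fun (delta : R) (z0 : R * R) =>
      (forall (z : R * R) (r : R), closure Om z -> 0 < r <= delta ->
         Rabs (fst z - fst z0) <= r -> Rabs (snd z - snd z0) <= r ->
         Rabs (trace Om F z - taylor (trace_at Om z0) k F (fst z - fst z0) (snd z - snd z0))
         <= / delta * r ^ (S k)) /\
      (forall (j : nat) (x y : R), (j <= k)%nat -> Rabs x <= C -> Rabs y <= C ->
         Rabs (hom (trace_at Om z0) j F x y) <= / delta)).
  destruct (uniform_on_frontier Om Q rho) as (delta & Hd & H).
  - intros d d' z Hd [Q1 Q2].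
    assert (Hi : / d <= / d') by (apply Rinv_le_contravar; lra).
    split.
    + intros z' r Cz Hr H1 H2. eapply Rle_trans; [apply (Q1 z' r); auto; lra|].
      apply Rmult_le_compat_r; auto. apply pow_le; lra.
    + intros j x y Hj Hx Hy. eapply Rle_trans; [apply Q2; auto|]. exact Hi.
  - intros z0 F0.
    destruct (taylor_boundary Om k F z0 HO HS HF F0) as (d1 & K1 & Hd1 & HK1 & H1).
    destruct (hom_bounded_upto Om k F z0 C (Ck_open_pred _ _ _ HF) (proj1 F0) HC) as (d2 & K2 & Hd2 & HK2 & H2).
    set (d := Rmin (d1 / 2) (Rmin d2 (Rmin (/ (K1 + 1)) (/ (K2 + 1))))).
    assert (Hi1 : 0 < / (K1 + 1)) by (apply Rinv_0_lt_compat; lra).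
    assert (Hi2 : 0 < / (K2 + 1)) by (apply Rinv_0_lt_compat; lra).
    assert (Hd : 0 < d) by (unfold d; repeat apply Rmin_pos; lra).
    assert (L1 : d <= d1 / 2) by apply Rmin_l.
    assert (L2 : d <= d2) by (eapply Rle_trans; [apply Rmin_r|apply Rmin_l]).
    assert (L3 : d <= / (K1 + 1)).
    { eapply Rle_trans; [apply Rmin_r|]. eapply Rle_trans; [apply Rmin_r|]. apply Rmin_l. }
    assert (L4 : d <= / (K2 + 1)).
    { eapply Rle_trans; [apply Rmin_r|]. eapply Rle_trans; [apply Rmin_r|]. apply Rmin_r. }
    assert (I1 : K1 <= / d).
    { apply Rinv_le_contravar in L3; auto. rewrite Rinv_inv in L3. lra. }
    assert (I2 : K2 <= / d).
    { apply Rinv_le_contravar in L4; auto. rewrite Rinv_inv in L4. lra. }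
    exists d. split; auto. intros z Fz Bz. split.
    + intros z' r Cz' Hr Hx Hy. apply Rle_trans with (K1 * r ^ S k).
      * apply H1; auto; try lra.
        -- apply Fz.
        -- eapply ball_le; [|exact Bz]. lra.
        -- apply (proj1 (ball_pair _ _ _)) in Bz. apply (proj2 (ball_pair _ _ _)).
           destruct Bz as [Bx By]. apply Rabs_def2 in Bx. apply Rabs_def2 in By.
           apply Rabs_le_between in Hx. apply Rabs_le_between in Hy.
           split; apply Rabs_def1; lra.
      * apply Rmult_le_compat_r; auto. apply pow_le; lra.
    + intros j x y Hj Hx Hy. apply Rle_trans with K2; auto. apply H2; auto.
      * apply Fz.
      * eapply ball_le; [|exact Bz]. auto.
  - exists delta, (/ delta). split; auto. split; [left; apply Rinv_0_lt_compat; auto|].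
    exact H.
Qed.

(** The last point of the segment in the closure is a frontier point: beyond it
    there are points outside [D] arbitrarily near. *)
Lemma segment_meets_frontier (D : R * R -> Prop) (A B : R * R) :
  closure D A -> ~ closure D B -> exists th, 0 <= th <= 1 /\ frontier D (segment A B th).
Proof.
  intros CA CB.
  set (E := fun th => 0 <= th <= 1 /\ closure D (segment A B th)).
  assert (E0 : E 0).
  { split; [lra|]. replace (segment A B 0) with A; auto.
    destruct A; unfold segment; simpl; f_equal; ring. }
  destruct (completeness E) as [s [Hub Hlub]].
  { exists 1. intros th [H _]. lra. }
  { exists 0. exact E0. }
  assert (Hs : 0 <= s <= 1).
  { split; [apply Hub, E0|]. apply Hlub. intros th [H _]. lra. }
  set (L := dist1 A B + 1).
  assert (HL : 0 < L) by (unfold L; pose proof (dist1_pos A B); lra).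
  assert (near : forall (eps : posreal) th, Rabs (th - s) < eps / L ->
            ball (segment A B s) eps (segment A B th)).
  { intros eps th H. apply (proj2 (ball_pair _ _ _)).
    apply (Rmult_lt_compat_r L) in H; auto. unfold Rdiv in H.
    rewrite Rmult_assoc, Rinv_l, Rmult_1_r in H by lra.
    pose proof (Rabs_pos (th - s)). pose proof (Rabs_pos (fst B - fst A)). pose proof (Rabs_pos (snd B - snd A)).
    unfold segment; simpl. split.
    - replace (fst A + th * (fst B - fst A) - (fst A + s * (fst B - fst A)))
        with ((th - s) * (fst B - fst A)) by ring.
      rewrite Rabs_mult. eapply Rle_lt_trans; [|exact H]. apply Rmult_le_compat_l; auto.
      unfold L, dist1. lra.
    - replace (snd A + th * (snd B - snd A) - (snd A + s * (snd B - snd A)))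
        with ((th - s) * (snd B - snd A)) by ring.
      rewrite Rabs_mult. eapply Rle_lt_trans; [|exact H]. apply Rmult_le_compat_l; auto.
      unfold L, dist1. lra. }
  assert (Cs : closure D (segment A B s)).
  { intros eps. set (e := pos_div_2 eps).
    assert (He : 0 < e / L) by (apply Rdiv_lt_0_compat; [apply cond_pos | auto]).
    assert (Hex : exists th, E th /\ s - e / L < th).
    { apply NNPP. intro N. assert (s <= s - e / L); [|lra]. apply Hlub. intros th Eth.
      apply Rnot_lt_le. intro Hlt. apply N. exists th; auto. }
    destruct Hex as (th & Eth & Hth). pose proof (Hub th Eth).
    destruct (proj2 Eth e) as (w & Dw & Bw). exists w. split; auto.
    replace (pos eps) with (e + e) by (unfold e; simpl; lra).
    apply ball_triangle with (segment A B th); auto. apply near. apply Rabs_def1; lra. }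
  exists s. split; auto. split; auto.
  intros eps.
  assert (Hs1 : s < 1).
  { destruct (proj2 Hs) as [H | ->]; auto. exfalso. apply CB.
    replace B with (segment A B 1); auto. destruct B; unfold segment; simpl; f_equal; ring. }
  assert (He : 0 < eps / L) by (apply Rdiv_lt_0_compat; [apply cond_pos | auto]).
  set (th := s + Rmin (eps / L) (1 - s) / 2).
  assert (Hm : 0 < Rmin (eps / L) (1 - s)) by (apply Rmin_pos; lra).
  pose proof (Rmin_l (eps / L) (1 - s)). pose proof (Rmin_r (eps / L) (1 - s)).
  exists (segment A B th). split.
  - intro Dth. assert (th <= s); [|unfold th in *; lra].
    apply Hub. split; [unfold th; lra|]. apply subset_closure, Dth.
  - apply near. unfold th. apply Rabs_def1; lra.
Qed.

Lemma dist_euc_ge (x0 y0 x1 y1 : R) :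
  Rabs (x0 - x1) <= dist_euc x0 y0 x1 y1 /\ Rabs (y0 - y1) <= dist_euc x0 y0 x1 y1.
Proof.
  unfold dist_euc. split; rewrite <- sqrt_Rsqr_abs; apply sqrt_le_1_alt;
    pose proof (Rle_0_sqr (x0 - x1)); pose proof (Rle_0_sqr (y0 - y1)); lra.
Qed.

Lemma dist_euc_le (x0 y0 x1 y1 : R) :
  dist_euc x0 y0 x1 y1 <= Rabs (x0 - x1) + Rabs (y0 - y1).
Proof.
  pose proof (Rabs_pos (x0 - x1)). pose proof (Rabs_pos (y0 - y1)).
  unfold dist_euc. rewrite <- (sqrt_Rsqr (Rabs (x0 - x1) + Rabs (y0 - y1))) by lra.
  apply sqrt_le_1_alt. rewrite (Rsqr_abs (x0 - x1)), (Rsqr_abs (y0 - y1)). unfold Rsqr. nra.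
Qed.

(** A neighbor of an irregular center lies outside the closure, so the segment
    joining them meets the frontier within [h] in each coordinate, and the
    nearest frontier point cannot be farther away. *)
Lemma projection_close (Om : R * R -> Prop) (h : R) (i j : Z) (z0 : R * R) :
  0 < h -> irregular_center Om h i j -> is_projection Om (grid_point h i j) z0 ->
  Rabs (fst (grid_point h i j) - fst z0) <= 2 * h /\ Rabs (snd (grid_point h i j) - snd z0) <= 2 * h.
Proof.
  intros Hh [Cc Hir] [_ Hpr].
  apply not_all_ex_not in Hir. destruct Hir as [m Hir].
  apply not_all_ex_not in Hir. destruct Hir as [n Hir].
  apply imply_to_and in Hir. destruct Hir as [Hm Hir].
  apply imply_to_and in Hir. destruct Hir as [Hn Hir].
  destruct (segment_meets_frontier Om _ _ Cc Hir) as (th & Hth & Fth).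
  set (zc := grid_point h i j) in *. set (z' := grid_point h (i + m) (j + n)) in *.
  specialize (Hpr _ Fth).
  assert (unit : forall k, (-1 <= k <= 1)%Z -> Rabs (th * (IZR k * h)) <= h).
  { intros k Hk. assert (Rabs (IZR k) <= 1).
    { apply Rabs_le. split; [apply (IZR_le (-1)) | apply (IZR_le _ 1)]; lia. }
    rewrite !Rabs_mult, (Rabs_right th), (Rabs_right h) by lra.
    pose proof (Rabs_pos (IZR k)).
    assert (Rabs (IZR k) * h <= h) by nra. assert (0 <= Rabs (IZR k) * h) by nra. nra. }
  assert (X : Rabs (fst zc - fst (segment zc z' th)) <= h).
  { replace (fst zc - fst (segment zc z' th)) with (- (th * (IZR m * h))).
    - rewrite Rabs_Ropp. auto.
    - unfold segment, zc, z', grid_point; simpl. rewrite plus_IZR. ring. }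
  assert (Y : Rabs (snd zc - snd (segment zc z' th)) <= h).
  { replace (snd zc - snd (segment zc z' th)) with (- (th * (IZR n * h))).
    - rewrite Rabs_Ropp. auto.
    - unfold segment, zc, z', grid_point; simpl. rewrite plus_IZR. ring. }
  destruct (dist_euc_ge (fst zc) (snd zc) (fst z0) (snd z0)) as [D1 D2].
  assert (Hd : dist_euc (fst zc) (snd zc) (fst z0) (snd z0) <= 2 * h) .
  { eapply Rle_trans; [exact Hpr|]. eapply Rle_trans; [apply dist_euc_le|].
    replace (2 * h) with (h + h) by ring. apply Rplus_le_compat; [exact X | exact Y]. }
  split; eapply Rle_trans; [exact D1 | exact Hd | exact D2 | exact Hd].
Qed.

(** * Sums over the stencil *)

Lemma sum_n_morphism {G H : AbelianMonoid} (f : G -> H) (a : nat -> G) (n : nat) :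
  (forall x y, f (plus x y) = plus (f x) (f y)) ->
  f (sum_n a n) = sum_n (fun k => f (a k)) n.
Proof.
  intros Hp. induction n as [|n IH]; rewrite ?sum_O, ?sum_Sn; auto. rewrite Hp, IH. reflexivity.
Qed.

Lemma sum_stencil_morphism {G H : AbelianMonoid} (f : G -> H) (S : Z -> Z -> Prop) (F : Z -> Z -> G) :
  f zero = zero -> (forall x y, f (plus x y) = plus (f x) (f y)) ->
  f (sum_stencil S F) = sum_stencil S (fun r l => f (F r l)).
Proof.
  intros H0 Hp. unfold sum_stencil. rewrite sum_n_morphism; auto. apply sum_n_ext. intro m.
  rewrite sum_n_morphism; auto. apply sum_n_ext. intro n. cbv zeta.
  destruct excluded_middle_informative; auto.
Qed.

Lemma sum_stencil_ext {G : AbelianMonoid} (S : Z -> Z -> Prop) (F F' : Z -> Z -> G) :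
  (forall r l, S r l -> F r l = F' r l) -> sum_stencil S F = sum_stencil S F'.
Proof.
  intros E. unfold sum_stencil. apply sum_n_ext. intro m. apply sum_n_ext. intro n. cbv zeta.
  destruct excluded_middle_informative; auto.
Qed.

Lemma sum_stencil_plus {G : AbelianMonoid} (S : Z -> Z -> Prop) (F F' : Z -> Z -> G) :
  sum_stencil S (fun r l => plus (F r l) (F' r l)) = plus (sum_stencil S F) (sum_stencil S F').
Proof.
  unfold sum_stencil. rewrite <- sum_n_plus. apply sum_n_ext. intro m.
  rewrite <- sum_n_plus. apply sum_n_ext. intro n. cbv zeta.
  destruct excluded_middle_informative; auto. symmetry. apply plus_zero_r.
Qed.

Lemma sum_n_bound (a : nat -> R) (n : nat) (b : R) :
  (forall k, Rabs (a k) <= b) -> Rabs (sum_n a n) <= INR (S n) * b.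
Proof.
  intros Ha. induction n as [|n IH].
  - rewrite sum_O. simpl. specialize (Ha 0%nat). lra.
  - rewrite sum_Sn, (S_INR (S n)). eapply Rle_trans; [apply Rabs_triang|].
    specialize (Ha (S n)). lra.
Qed.

Lemma sum_stencil_bound (S : Z -> Z -> Prop) (F : Z -> Z -> R) (b : R) :
  0 <= b -> (forall r l, S r l -> Rabs (F r l) <= b) -> Rabs (sum_stencil S F) <= 9 * b.
Proof.
  intros Hb HF. unfold sum_stencil. replace (9 * b) with (INR 3 * (INR 3 * b)) by (simpl; ring).
  apply sum_n_bound. intro m. apply sum_n_bound. intro n. cbv zeta.
  destruct excluded_middle_informative; auto. change zero with 0. rewrite Rabs_R0. auto.
Qed.

Lemma sum_stencil_scal (S : Z -> Z -> Prop) (F : Z -> Z -> R) (k : R) :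
  sum_stencil S (fun r l => k * F r l) = k * sum_stencil S F.
Proof.
  symmetry. apply (sum_stencil_morphism (fun x : R => k * x)).
  - exact (Rmult_0_r k).
  - intros x y. exact (Rmult_plus_distr_l k x y).
Qed.

(** * One stencil point *)

Definition system_row {B : bdata} (mu tau : R) (c : Z -> Z -> nat -> R) (k : nat) (r l : Z) : R :=
  coeff_mat 0 (Mmult (stencil_matrix mu tau) (coef_vector c r l)) k 0.

Lemma system_rows {B : bdata} (mu tau : R) (c : Z -> Z -> nat -> R) (r l : Z) :
  let m11 := tau * xi1 + mu in
  let m21 := mu^2 * xi9 + tau^2 * xi7 + mu * tau in
  let m31 := mu^2 * tau * xi13 + tau^3 * xi12 - mu^3 / 6 + mu * tau^2 / 2 in
  let m41 := mu^2 * xi4 + tau^2 * xi2 in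
  let m51 := mu^3 * xi11 + mu^2 * tau * xi10 + tau^3 * xi8 in
  let m61 := mu^3 * xi6 + mu^2 * tau * xi5 + tau^3 * xi3 in
  let row k := system_row mu tau c k r l in
  row 0%nat = m11 * c r l 0%nat /\
  row 1%nat = m21 * c r l 0%nat /\
  row 2%nat = m31 * c r l 0%nat /\
  row 3%nat = m41 * c r l 0%nat + m11 * c r l 1%nat /\
  row 4%nat = m51 * c r l 0%nat + m21 * c r l 1%nat /\
  row 5%nat = m61 * c r l 0%nat + m41 * c r l 1%nat + m11 * c r l 2%nat.
Proof.
  intros m11 m21 m31 m41 m51 m61 row.
  assert (E : forall k, (k < 6)%nat -> row k = 
    sum_n (fun s => coeff_mat 0 (stencil_matrix mu tau) k s * c r l s) 3).
  { intros k Hk. unfold row, system_row, Mmult. rewrite coeff_mat_bij by lia.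
    apply sum_n_ext_loc. intros s Hs. unfold coef_vector. rewrite coeff_mat_bij by lia. reflexivity. }
  repeat split; rewrite E by lia; rewrite !sum_Sn, sum_O;
    change plus with Rplus; unfold stencil_matrix; fold m11 m21 m31 m41 m51 m61;
    clearbody m11 m21 m31 m41 m51 m61; cbv [coeff_mat coeff_Tn fst snd]; simpl; real_ring.
Qed.

Lemma system_row_sum {B : bdata} (S : Z -> Z -> Prop) (w v : R) (c : Z -> Z -> nat -> R) (k : nat) :
  (k < 6)%nat -> solves_system S w v c ->
  sum_stencil S (fun r l => system_row (IZR r + w) (IZR l + v) c k r l) = 0.
Proof.
  intros Hk [H0 _].
  apply (f_equal (fun A => coeff_mat 0 A k 0)) in H0.
  unfold Mzero in H0. rewrite coeff_mat_bij in H0 by lia.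
  refine (eq_trans (eq_sym _) H0).
  apply (sum_stencil_morphism (G := matrix_AbelianMonoid) (fun A : @matrix R 6 1 => coeff_mat 0 A k 0)).
  - exact (coeff_mat_bij 0 (fun _ _ => 0) k 0 Hk Nat.lt_0_1).
  - intros x y. exact (coeff_mat_bij 0 (fun i j => coeff_mat 0 x i j + coeff_mat 0 y i j) k 0 Hk Nat.lt_0_1).
Qed.

Definition rhs_term {B : bdata} (mu tau h c0 c1 c2 c3 : R) : R :=
  c0 * g0
  + (c0 * g1 * om6 * tau + c1 * g0) * h
  + (c0 * (known_yy * tau^2 + mu^2 * known_xx) + c1 * g1 * om6 * tau + c2 * g0) * h^2
  + (c0 * (known_yyy * tau^3 + mu^2 * known_xxy * tau + mu^3 * known_xxx)
     + c1 * known_yy * tau^2 + c2 * g1 * om6 * tau + c1 * known_xx * mu^2 + c3 * g0) * h^3.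

(** Expanding the product of the coefficient polynomial and the Taylor
    polynomial and dropping the powers of [h] above the third gives the
    right-hand side up to a combination of [u_x], [u_xy], [u_xyy]. The rows of
    the matrix are exactly the coefficients of that combination. *)
Lemma truncated_product {B : bdata} (u : R * R -> R) (ev : (R * R -> R) -> R)
    (c : Z -> Z -> nat -> R) (r l : Z) (mu tau h : R) :
  ev u = g0 -> ev (dx (dy u)) = ev (dy (dx u)) ->
  ev (dx (dy (dx u))) = ev (dy (dx (dx u))) -> ev (dx (dx (dy u))) = ev (dy (dx (dx u))) ->
  ev (dy (dx (dy u))) = ev (dy (dy (dx u))) -> ev (dx (dy (dy u))) = ev (dy (dy (dx u))) ->
  q1 <> 0 -> D2 <> 0 -> D3 <> 0 ->
  boundary_system (ev (dx u)) (ev (dy u)) (ev (dx (dx u))) (ev (dy (dx u))) (ev (dy (dy u)))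
    (ev (dx (dx (dx u)))) (ev (dy (dx (dx u)))) (ev (dy (dy (dx u)))) (ev (dy (dy (dy u)))) ->
  let H j := hom ev j u mu tau in
  let cc := c r l in
  let row k := system_row mu tau c k r l in
  cc 0%nat * H 0%nat + (cc 0%nat * H 1%nat + cc 1%nat * H 0%nat) * h
  + (cc 0%nat * H 2%nat + cc 1%nat * H 1%nat + cc 2%nat * H 0%nat) * h ^ 2
  + (cc 0%nat * H 3%nat + cc 1%nat * H 2%nat + cc 2%nat * H 1%nat + cc 3%nat * H 0%nat) * h ^ 3
  = rhs_term mu tau h (cc 0%nat) (cc 1%nat) (cc 2%nat) (cc 3%nat)
  + (ev (dx u) * h * row 0%nat
     + (ev (dx u) * h ^ 2 * row 3%nat + ev (dy (dx u)) * h ^ 2 * row 1%nat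
     + (ev (dx u) * h ^ 3 * row 5%nat + ev (dy (dx u)) * h ^ 3 * row 4%nat
        + ev (dy (dy (dx u))) * h ^ 3 * row 2%nat))).
Proof.
  intros E0 M1 M2 M3 M4 M5 Hq HD2 HD3 HR H cc row.
  destruct (derivatives_from_boundary_system _ _ _ _ _ _ _ _ _ Hq HD2 HD3 HR) as (ey & eyy & exx & eyyy & exxy & exxx).
  destruct (system_rows mu tau c r l) as (r0 & r1 & r2 & r3 & r4 & r5).
  unfold row, cc. clear row cc. rewrite r0, r1, r2, r3, r4, r5.
  change (H 0%nat) with (ev u). 
  assert (H1 : H 1%nat = mu * ev (dx u) + tau * ev (dy u)) by (unfold H, hom; simpl INR; field).
  assert (H2 : H 2%nat = (mu ^ 2 * ev (dx (dx u)) + 2 * mu * tau * ev (dy (dx u)) + tau ^ 2 * ev (dy (dy u))) / 2).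
  { unfold H, hom; simpl INR. rewrite M1. field. }
  assert (H3 : H 3%nat = (mu ^ 3 * ev (dx (dx (dx u))) + 3 * mu ^ 2 * tau * ev (dy (dx (dx u)))
     + 3 * mu * tau ^ 2 * ev (dy (dy (dx u))) + tau ^ 3 * ev (dy (dy (dy u)))) / 6).
  { unfold H, hom; simpl INR. rewrite M2, M3, M4, M5. field. }
  rewrite H1, H2, H3, E0, exxx, exxy, eyyy, exx, eyy, ey.
  unfold rhs_term. clear. field.
Qed.

(** * Consistency *)

(** The constant is [330 = 4 * 81 + 6]: four coefficients times the remainder at
    distance [3 h], and the six products of total degree at least four. *)
Lemma product_remainder (c0 c1 c2 c3 H0 H1 H2 H3 U h M K : R) :
  0 < h <= 1 ->
  Rabs c0 <= M -> Rabs c1 <= M -> Rabs c2 <= M -> Rabs c3 <= M ->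
  Rabs H1 <= K -> Rabs H2 <= K -> Rabs H3 <= K ->
  Rabs (U - (H0 + h * H1 + h ^ 2 * H2 + h ^ 3 * H3)) <= K * (3 * h) ^ 4 ->
  Rabs ((c0 + c1 * h + c2 * h ^ 2 + c3 * h ^ 3) * U
        - (c0 * H0 + (c0 * H1 + c1 * H0) * h + (c0 * H2 + c1 * H1 + c2 * H0) * h ^ 2
           + (c0 * H3 + c1 * H2 + c2 * H1 + c3 * H0) * h ^ 3)) <= 330 * M * K * h ^ 4.
Proof.
  intros Hh B0 B1 B2 B3 K1 K2 K3 HU.
  set (D := U - (H0 + h * H1 + h ^ 2 * H2 + h ^ 3 * H3)) in *.
  set (P := c0 + c1 * h + c2 * h ^ 2 + c3 * h ^ 3).
  set (Q := c1 * H3 + c2 * H2 + c3 * H1 + (c2 * H3 + c3 * H2) * h + c3 * H3 * h ^ 2).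
  match goal with |- Rabs ?x <= _ => replace x with (P * D + Q * h ^ 4) by (unfold P, D, Q; ring) end.
  assert (M0 : 0 <= M) by (pose proof (Rabs_pos c0); lra).
  assert (K0 : 0 <= K) by (pose proof (Rabs_pos H1); lra).
  assert (small : forall n, 0 <= h ^ n <= 1).
  { intro n. split; [apply pow_le; lra|]. rewrite <- (pow1 n). apply pow_incr; lra. }
  assert (mul : forall a s x, Rabs a <= s -> 0 <= x <= 1 -> Rabs (a * x) <= s).
  { intros a s x Ha Hx. rewrite Rabs_mult, (Rabs_right x) by lra.
    pose proof (Rabs_pos a). nra. }
  assert (prod : forall a b, Rabs a <= M -> Rabs b <= K -> Rabs (a * b) <= M * K).
  { intros a b Ha Hb. rewrite Rabs_mult. apply Rmult_le_compat; auto using Rabs_pos. }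
  assert (add : forall a b s t, Rabs a <= s -> Rabs b <= t -> Rabs (a + b) <= s + t).
  { intros a b s t Ha Hb. eapply Rle_trans; [apply Rabs_triang|]. lra. }
  assert (BP : Rabs P <= M + M + M + M).
  { unfold P. repeat apply add; auto; apply mul; auto. lra. }
  assert (BQ : Rabs Q <= M * K + M * K + M * K + (M * K + M * K) + M * K).
  { unfold Q. repeat apply add; auto; apply mul; auto; lra. }
  replace (330 * M * K * h ^ 4)
    with ((M + M + M + M) * (K * (3 * h) ^ 4)
          + (M * K + M * K + M * K + (M * K + M * K) + M * K) * h ^ 4) by ring.
  apply add.
  - rewrite Rabs_mult. apply Rmult_le_compat; auto using Rabs_pos.
  - rewrite Rabs_mult, (Rabs_right (h ^ 4)) by (apply Rle_ge, small).
    apply Rmult_le_compat_r; [apply small | auto].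
Qed.

Lemma taylor_3 (ev : (R * R -> R) -> R) (F : R * R -> R) (h X Y : R) :
  taylor ev 3 F (h * X) (h * Y)
  = ev F + h * hom ev 1 F X Y + h ^ 2 * hom ev 2 F X Y + h ^ 3 * hom ev 3 F X Y.
Proof.
  rewrite !taylor_S. unfold taylor. rewrite sum_O, !hom_scale.
  change (hom ev 0 F X Y) with (ev F). ring.
Qed.

(** If [q1] vanished, so would [p1]; the other two factor as
    [(p1 - q1) (p1 + q1)] and [(sqrt 3 p1 - q1) (sqrt 3 p1 + q1)]. *)
Lemma nondegenerate_denominators {B : bdata} :
  p1 ^ 2 + q1 ^ 2 <> 0 -> Rabs p1 <= Rabs q1 -> q1 <> p1 -> q1 <> - p1 ->
  q1 <> sqrt 3 * p1 -> q1 <> - (sqrt 3 * p1) ->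
  q1 <> 0 /\ D2 <> 0 /\ D3 <> 0.
Proof.
  intros Hn Hle H1 H2 H3 H4. split; [|split].
  - intro E. rewrite E, Rabs_R0 in Hle. pose proof (Rabs_pos p1).
    assert (p1 = 0) by (destruct (Req_dec p1 0) as [|N]; auto; pose proof (Rabs_pos_lt _ N); lra).
    apply Hn. rewrite E, H0. ring.
  - unfold D2. replace (p1 ^ 2 - q1 ^ 2) with ((p1 - q1) * (p1 + q1)) by ring.
    apply Rmult_integral_contrapositive_currified; lra.
  - unfold D3. assert (E3 : sqrt 3 * sqrt 3 = 3) by (apply sqrt_sqrt; lra).
    replace (3 * p1 ^ 2 - q1 ^ 2) with ((sqrt 3 * p1 - q1) * (sqrt 3 * p1 + q1)).
    + apply Rmult_integral_contrapositive_currified; lra.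
    + transitivity ((sqrt 3 * sqrt 3) * p1 ^ 2 - q1 ^ 2); [ring | rewrite E3; reflexivity].
Qed.

Theorem theorem3p1
  (Om : R * R -> Prop) (T : R -> Prop)
  (alpha beta1 beta2 kappa phi u : R * R -> R) (p q g : R -> R)
  (Om_open : open Om) (Om_connected : connected Om) (Om_origin : Om (0, 0))
  (Om_smooth : smooth_boundary Om)
  (T_interval : nontrivial_interval T)
  (Om_param : parametrizes_boundary Om T p q)
  (p_reg : Ck_interval 3 T p) (q_reg : Ck_interval 3 T q)
  (g_reg : Ck_interval 3 T g)
  (alpha_reg : Ck_closure 2 Om alpha)
  (beta1_reg : Ck_closure 2 Om beta1) (beta2_reg : Ck_closure 2 Om beta2)
  (kappa_reg : Ck_closure 2 Om kappa) (phi_reg : Ck_closure 2 Om phi)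
  (u_reg : Ck_closure 4 Om u)
  (alpha_pos : forall z, closure Om z -> 0 < alpha z)
  (u_pde : solves_pde Om alpha beta1 beta2 kappa phi u)
  (u_bc : forall t, T t -> u (p t, q t) = g t) :
  (* [M] bounds the coefficients [c], [rho] confines the stencil centers to a
     bounded region (no restriction when [Om] is bounded) *)
  forall M rho : R, exists K h0 : R, 0 < h0 /\
  forall (N : nat) (i j : Z) (t : R) (c : Z -> Z -> nat -> R),
    let h := / INR N in
    let B := boundary_data Om T alpha beta1 beta2 kappa phi p q g t in
    let S := in_stencil Om h i j in
    let w := (fst (grid_point h i j) - p t) / h in
    let v := (snd (grid_point h i j) - q t) / h in
    (0 < N)%nat ->
    irregular_center Om h i j ->
    T t -> is_projection Om (grid_point h i j) (p t, q t) ->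
    (@p1 B)^2 + (@q1 B)^2 <> 0 ->
    Rabs (@p1 B) <= Rabs (@q1 B) ->
    @q1 B <> @p1 B -> @q1 B <> - @p1 B ->
    @q1 B <> sqrt 3 * @p1 B -> @q1 B <> - (sqrt 3 * @p1 B) ->
    @solves_system B S w v c ->
    @scheme_rhs B S w v c 0 = g t /\
    (Rabs (fst (grid_point h i j)) <= rho ->
     Rabs (snd (grid_point h i j)) <= rho ->
     (forall r l sigma, S r l -> (sigma <= 3)%nat -> Rabs (c r l sigma) <= M) ->
     h <= h0 ->
     Rabs (scheme_op S h c (fun i' j' => u (grid_point h i' j')) i j
           - @scheme_rhs B S w v c h) <= K * h^4).
Proof.
  intros M rho.
  destruct u_reg as [u_cont u_C4].
  destruct (uniform_taylor Om 3 u (rho + 2) 3 Om_open Om_smooth u_C4 ltac:(lra))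
    as (delta & K & Hdelta & HK & Huni).
  (* All stencil points lie within [3 h] of the boundary point in each
     coordinate, and the stencil has at most nine points. *)
  exists (9 * (330 * Rabs M * K)), (delta / 3). split; [lra|].
  intros N i j t c h B S w v HN Hirr Tt Hproj Hn Hle H1 H2 H3 H4 Hsys.
  assert (HN1 : 1 <= INR N) by (apply (le_INR 1); lia).
  assert (Hh : 0 < h) by (apply Rinv_0_lt_compat; lra).
  assert (Hh1 : h <= 1) by (rewrite <- Rinv_1; apply Rinv_le_contravar; lra).
  pose proof Hsys as (_ & _ & Hsum).
  split.
  { transitivity (sum_stencil S (fun r l => g t * c r l 0%nat)).
    - unfold scheme_rhs. apply sum_stencil_ext. intros r l _. cbv zeta.
      change (@g0 B) with (g t). real_ring.
    - rewrite sum_stencil_scal, Hsum. exact (Rmult_1_r (g t)). }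
  intros Hr1 Hr2 HM Hh0.
  set (z0 := (p t, q t)).
  pose proof (proj1 Hproj : frontier Om z0) as Fz0.
  destruct (projection_close Om h i j z0 Hh Hirr Hproj) as [Hw Hv].
  destruct (nondegenerate_denominators (B := B) Hn Hle H1 H2 H3 H4) as (Nq & N2 & N3).
  pose proof (boundary_relations Om T alpha beta1 beta2 kappa phi u p q g t Om_open Om_smooth
    T_interval Om_param p_reg q_reg g_reg alpha_reg beta1_reg beta2_reg kappa_reg phi_reg
    (conj u_cont u_C4) alpha_pos u_pde u_bc Tt) as HR.
  destruct (trace_mixed Om u z0 Om_open u_C4 (proj1 Fz0)) as (M1 & M2 & M3 & M4 & M5).
  assert (Eu : trace Om u z0 = g t) by exact (eq_trans (trace_on_closure Om u z0 u_cont (proj1 Fz0)) (u_bc t Tt)).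
  set (ev := trace_at Om z0).
  destruct (Huni z0 Fz0) as [Htaylor Hhom].
  { apply Rabs_le_between in Hr1. apply Rabs_le_between in Hw. apply Rabs_le. lra. }
  { apply Rabs_le_between in Hr2. apply Rabs_le_between in Hv. apply Rabs_le. lra. }
  (* The product of coefficient polynomial and Taylor polynomial up to [h ^ 3]. *)
  set (trunc := fun r l =>
    let H j := hom ev j u (IZR r + w) (IZR l + v) in
    c r l 0%nat * H 0%nat + (c r l 0%nat * H 1%nat + c r l 1%nat * H 0%nat) * h
    + (c r l 0%nat * H 2%nat + c r l 1%nat * H 1%nat + c r l 2%nat * H 0%nat) * h ^ 2
    + (c r l 0%nat * H 3%nat + c r l 1%nat * H 2%nat + c r l 2%nat * H 1%nat
       + c r l 3%nat * H 0%nat) * h ^ 3).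
  assert (Htrunc : sum_stencil S trunc = @scheme_rhs B S w v c h).
  { change (@scheme_rhs B S w v c h) with (sum_stencil S (fun r l =>
      rhs_term (IZR r + w) (IZR l + v) h (c r l 0%nat) (c r l 1%nat) (c r l 2%nat) (c r l 3%nat))).
    rewrite (sum_stencil_ext S trunc _ (fun r l _ =>
      truncated_product (B := B) u ev c r l (IZR r + w) (IZR l + v) h
        Eu M1 M2 M3 M4 M5 Nq N2 N3 HR)).
    rewrite (sum_stencil_plus (G := R_AbelianMonoid)).
    match goal with |- plus ?a ?b = _ => assert (Z : b = 0) end.
    { repeat (rewrite (sum_stencil_plus (G := R_AbelianMonoid))).
      rewrite !sum_stencil_scal, !system_row_sum by (auto; lia).
      change plus with Rplus. real_ring. }
    rewrite Z. exact (Rplus_0_r _). }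
  rewrite <- Htrunc. unfold scheme_op.
  match goal with |- Rabs (sum_stencil S ?F - _) <= _ =>
    replace (sum_stencil S F - sum_stencil S trunc)
      with (sum_stencil S (fun r l => F r l + -1 * trunc r l)) end.
  2: { rewrite (sum_stencil_plus (G := R_AbelianMonoid)), sum_stencil_scal.
       change plus with Rplus. real_ring. }
  replace (9 * (330 * Rabs M * K) * h ^ 4) with (9 * (330 * Rabs M * K * h ^ 4)) by ring.
  apply sum_stencil_bound.
  { repeat apply Rmult_le_pos; try apply Rabs_pos; try lra. }
  intros r l Srl. destruct Srl as (Hr & Hl & Cz).
  set (mu := IZR r + w). set (tau := IZR l + v).
  assert (offset : forall k a, (-1 <= k <= 1)%Z -> Rabs a <= 2 * h -> Rabs (IZR k + a / h) <= 3).
  { intros k a Hk Ha.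
    assert (Rabs (IZR k) <= 1).
    { apply Rabs_le. split; [apply (IZR_le (-1)) | apply (IZR_le _ 1)]; lia. }
    assert (Rabs (a / h) <= 2).
    { unfold Rdiv. rewrite Rabs_mult, Rabs_inv, (Rabs_right h) by lra.
      apply (Rmult_le_reg_r h); auto. rewrite Rmult_assoc, Rinv_l; lra. }
    eapply Rle_trans; [apply Rabs_triang|]. lra. }
  assert (Bmu : Rabs mu <= 3) by (apply offset; auto).
  assert (Btau : Rabs tau <= 3) by (apply offset; auto).
  set (z := grid_point h (i + r) (j + l)) in *.
  assert (Ex : fst z - p t = h * mu).
  { unfold z, mu, w, grid_point; simpl. rewrite plus_IZR. field. lra. }
  assert (Ey : snd z - q t = h * tau).
  { unfold z, tau, v, grid_point; simpl. rewrite plus_IZR. field. lra. }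
  assert (Hbig : forall a, Rabs a <= 3 -> Rabs (h * a) <= 3 * h).
  { intros a Ha. rewrite Rabs_mult, (Rabs_right h) by lra. nra. }
  assert (HT : Rabs (u z - (ev u + h * hom ev 1 u mu tau + h ^ 2 * hom ev 2 u mu tau
                            + h ^ 3 * hom ev 3 u mu tau)) <= K * (3 * h) ^ 4).
  { rewrite <- taylor_3, <- Ex, <- Ey, <- (trace_on_closure Om u z u_cont Cz).
    apply (Htaylor z (3 * h) Cz); [lra | |].
    - change (fst z0) with (p t). rewrite Ex. auto.
    - change (snd z0) with (q t). rewrite Ey. auto. }
  assert (Bc : forall sigma, (sigma <= 3)%nat -> Rabs (c r l sigma) <= Rabs M).
  { intros sigma Hs. apply Rle_trans with M; [|apply Rle_abs]. apply HM; auto. exact (conj Hr (conj Hl Cz)). }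
  pose proof (product_remainder _ _ _ _ (ev u) _ _ _ (u z) h (Rabs M) K (conj Hh Hh1)
    (Bc 0%nat ltac:(lia)) (Bc 1%nat ltac:(lia)) (Bc 2%nat ltac:(lia)) (Bc 3%nat ltac:(lia))
    (Hhom 1%nat mu tau ltac:(lia) Bmu Btau) (Hhom 2%nat mu tau ltac:(lia) Bmu Btau)
    (Hhom 3%nat mu tau ltac:(lia) Bmu Btau) HT) as Hfin.
  match goal with |- Rabs ?x <= _ => match type of Hfin with Rabs ?y <= _ => replace x with y; [exact Hfin|] end end.
  unfold scheme_coef. rewrite !sum_Sn, sum_O. change plus with Rplus.
  unfold trunc, ev. fold mu tau. change (hom (trace_at Om z0) 0 u mu tau) with (trace_at Om z0 u).
  fold z. simpl pow. real_ring.
Qed.
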